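(* Let $H$ be a pointed Hopf algebra over $\mathbb{K}$ of discrete corepresentation type and let $B$ be the link-indecomposable component of $H$ containing $1$. Then the ${\rm Ext}$-quiver $Q$ of the comodule category $\mathcal{M}^B$ is one of the following: $(1)$ The single vertex $1$, and $G(B)=\{1\}$. $(2)$ A complete oriented cycle, and $G(B)=\langle a \mid a^n=1\rangle$; $(3)$ the doubly infinite linear quiver $\cdots\rightarrow\cdot\rightarrow\cdot\rightarrow\cdot\rightarrow\cdots$, and $G(B)=\langle a \rangle$ (infinite cyclic); $(4)$ $Q^{m,n}$, and $G(B)=\langle a,b \mid ab=ba,\ a^m=b^n\rangle$ for some integers $(m,n)\neq\pm(1,1)$. The ${\rm Ext}$-quiver of $\mathcal{M}^H$ is a disjoint union of (possibly infinitely many) copies of one of the quivers in $(1)$–$(4)$.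
   Context: $\mathbb{K}$ is an algebraically closed field. A pointed coalgebra $C$ is of discrete corepresentation type if for any finite dimension vector $\underline{d}$ there are only finitely many indecomposable $C$-comodules of dimension vector $\underline{d}$. $\mathcal{M}^C$ denotes the category of right $C$-comodules and $G(C)$ the group(-like set) of grouplike elements. For grouplikes $g,h$, $P(g,h)=\{x\in C \mid \Delta(x)=g\otimes x+x\otimes h\}$. The ${\rm Ext}$-quiver of $\mathcal{M}^C$ has the grouplikes of $C$ as vertices, and the number of arrows from $g$ to $h$ is $\dim P(g,h)-1$. The link-indecomposable component containing $1$ is the subcoalgebra containing $1$ that is maximal with respect to its ${\rm Ext}$-quiver being connected (as an undirected graph); it is a Hopf subalgebra. For integers $(m,n)\neq\pm(1,1)$, $Q^{m,n}$ is the quiver whose vertex set is the group $\langle a,b\mid ab=ba,\ a^m=b^n\rangle$ and which has, for each vertex $a^ib^j$, exactly one arrow $a^ib^j\to a^{i+1}b^j$ and exactly one arrow $a^ib^j\to a^ib^{j+1}$. *)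

(* Defs.v *)
(* Pointed Hopf algebras presented concretely:
   a Hopf algebra is an (arbitrary, possibly infinite-dimensional) K-algebra H
   with a comultiplication given as a finite list of simple tensors
   Delta x = sum_{(a,b) <- Delta x} a (x) b.  Elements of H (x) H (resp.
   H (x) H (x) H) are compared through all bilinear (trilinear) forms, which
   separate points of a tensor product of vector spaces over a field. *)
From HB Require Import structures.
From mathcomp Require Import all_boot all_order all_algebra.
Set Implicit Arguments. Unset Strict Implicit. Unset Printing Implicit Defensive.
Import Order.TTheory GRing.Theory Num.Theory.
Local Open Scope ring_scope.

Section Tensors.
Context {K : fieldType} {V : lmodType K}.

Definition bilin (f : V -> V -> K) : Prop :=
  (forall (a : K) x x' y, f (a *: x + x') y = a * f x y + f x' y) /\
  (forall (a : K) x y y', f x (a *: y + y') = a * f x y + f x y').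

Definition trilin (f : V -> V -> V -> K) : Prop :=
  (forall (a : K) x x' y z, f (a *: x + x') y z = a * f x y z + f x' y z) /\
  (forall (a : K) x y y' z, f x (a *: y + y') z = a * f x y z + f x y' z) /\
  (forall (a : K) x y z z', f x y (a *: z + z') = a * f x y z + f x y z').

(* equality of two elements of V (x) V given as lists of simple tensors *)
Definition teq2 (s t : seq (V * V)) : Prop :=
  forall f, bilin f -> \sum_(p <- s) f p.1 p.2 = \sum_(p <- t) f p.1 p.2.

Definition is_coalgebra (D : V -> seq (V * V)) (e : V -> K) : Prop :=
  (forall (a : K) x y, e (a *: x + y) = a * e x + e y) /\
  (forall (a : K) x y,
      teq2 (D (a *: x + y)) ([seq (a *: p.1, p.2) | p <- D x] ++ D y)) /\
  (forall T, trilin T -> forall x,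
      \sum_(p <- D x) \sum_(q <- D p.1) T q.1 q.2 p.2 =
      \sum_(p <- D x) \sum_(q <- D p.2) T p.1 q.1 q.2) /\
  (forall x, \sum_(p <- D x) e p.1 *: p.2 = x) /\
  (forall x, \sum_(p <- D x) e p.2 *: p.1 = x).

Definition subspace (C : V -> Prop) : Prop :=
  C 0 /\ forall (a : K) x y, C x -> C y -> C (a *: x + y).

Definition subcoalg (D : V -> seq (V * V)) (C : V -> Prop) : Prop :=
  subspace C /\
  forall x, C x -> exists s, teq2 (D x) s /\
                      forall p, p \in s -> C p.1 /\ C p.2.

Definition pointed (D : V -> seq (V * V)) : Prop :=
  forall C, subcoalg D C -> (exists x, C x /\ x <> 0) ->
    (forall C', subcoalg D C' -> (forall x, C' x -> C x) ->
       (exists x, C' x /\ x <> 0) -> forall x, C x -> C' x) ->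
    exists g, forall x, C x <-> exists a : K, x = a *: g.

Definition grouplike (D : V -> seq (V * V)) (g : V) : Prop :=
  g <> 0 /\ teq2 (D g) [:: (g, g)].

Definition GL (D : V -> seq (V * V)) (C : V -> Prop) (g : V) : Prop :=
  grouplike D g /\ C g.

Definition skewprim (D : V -> seq (V * V)) (g h x : V) : Prop :=
  teq2 (D x) [:: (g, x); (x, h)].

(* In the Ext-quiver of M^C there are exactly k arrows g -> h:
   dim ((P(g,h) \cap C) / K(g-h)) = k. *)
Definition arrows (D : V -> seq (V * V)) (C : V -> Prop) (g h : V) (k : nat)
  : Prop :=
  exists x : 'I_k -> V,
    (forall i, C (x i) /\ skewprim D g h (x i)) /\
    (forall (c : 'I_k -> K) (b : K),
        \sum_i c i *: x i = b *: (g - h) -> forall i, c i = 0) /\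
    (forall y, C y -> skewprim D g h y ->
        exists (c : 'I_k -> K) (b : K), y = \sum_i c i *: x i + b *: (g - h)).

Definition has_arrow (D : V -> seq (V * V)) (C : V -> Prop) (g h : V) : Prop :=
  exists x, C x /\ skewprim D g h x /\ forall b : K, x <> b *: (g - h).

Fixpoint walk (R : V -> V -> Prop) (x : V) (s : seq V) (y : V) : Prop :=
  match s with
  | [::] => x = y
  | z :: s' => R x z /\ walk R z s' y
  end.

Definition quiver_connected (D : V -> seq (V * V)) (C : V -> Prop) : Prop :=
  forall g h, GL D C g -> GL D C h ->
    exists s, walk (fun u v => GL D C v /\ (has_arrow D C u v \/ has_arrow D C v u))
                   g s h.

(* finite-dimensional right comodules, given by a basis: rho(e_j) = sum_i e_i (x) c i j *)
Definition comod (D : V -> seq (V * V)) (e : V -> K) (n : nat) (c : 'M[V]_n)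
  : Prop :=
  (forall i j, teq2 (D (c i j)) [seq (c i k, c k j) | k <- enum 'I_n]) /\
  (forall i j, e (c i j) = (i == j)%:R).

Definition comod_iso (n : nat) (c c' : 'M[V]_n) : Prop :=
  exists P : 'M[K]_n, P \in unitmx /\
    forall i j, \sum_k P i k *: c k j = \sum_k P k j *: c' i k.

Definition indecomposable (n : nat) (c : 'M[V]_n) : Prop :=
  (0 < n)%N /\
  ~ exists (c' : 'M[V]_n) (n1 : nat), comod_iso c c' /\ (0 < n1 < n)%N /\
      forall i j : 'I_n, (i < n1)%N != (j < n1)%N -> c' i j = 0.

(* dimension vector: multiplicities of the (one-dimensional) composition
   factors, read off a triangular form of the comodule *)
Definition dimvec (n : nat) (c : 'M[V]_n) (d : V -> nat) : Prop :=
  exists c' : 'M[V]_n, comod_iso c c' /\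
    (forall i j : 'I_n, (j < i)%N -> c' i j = 0) /\
    forall g, d g = #|[set i : 'I_n | c' i i == g]|.

Definition discrete_corep (D : V -> seq (V * V)) (e : V -> K) : Prop :=
  forall (n : nat) (d : V -> nat), exists s : seq 'M[V]_n,
    forall c, comod D e c -> indecomposable c -> dimvec c d ->
      exists c', c' \in s /\ comod_iso c c'.

End Tensors.

Definition is_hopf {K : fieldType} {H : algType K} (D : H -> seq (H * H))
  (e : H -> K) (S : H -> H) : Prop :=
  is_coalgebra D e /\
  (forall x y : H, teq2 (D (x * y)) [seq (p.1 * q.1, p.2 * q.2) | p <- D x, q <- D y]) /\
  teq2 (D 1) [:: (1, 1)] /\
  (forall x y : H, e (x * y) = e x * e y) /\ e 1 = 1 /\
  (forall (a : K) (x y : H), S (a *: x + y) = a *: S x + S y) /\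
  (forall x : H, \sum_(p <- D x) S p.1 * p.2 = e x *: 1) /\
  (forall x : H, \sum_(p <- D x) p.1 * S p.2 = e x *: 1).

Definition link_component_one {K : fieldType} {H : algType K}
  (D : H -> seq (H * H)) (B : H -> Prop) : Prop :=
  subcoalg D B /\ B 1 /\ quiver_connected D B /\
  forall B', subcoalg D B' -> B' 1 -> (forall x, B x -> B' x) ->
    quiver_connected D B' -> forall x, B' x -> B x.

(* Main.v *)
(* Translations by grouplikes act on the Ext-quiver, so it is determined by the set X
   of targets of arrows starting at 1, which is stable under conjugation.
   If g_0, g_1, ... are distinct sources and h_0, h_1, ... distinct sinks indexed
   by Z/N, with nontrivial x_i in P(g_i, h_i) and y_i in P(g_i, h_(i+1)) (jointly
   independent modulo K(g - h) when N = 1), then weighting one of the y_i by a scalar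
   lambda gives comodules of Loewy length 2 that are indecomposable and pairwise
   nonisomorphic, with the same dimension vector: discreteness fails.  N = 1 excludes
   multiple arrows; N = 2 forces the elements of X to commute; N = 3 forces |X| <= 2;
   and if X = {a, b} with a <> b, a cycle of length N excludes (a b^-1)^N = 1.
   G(B) is generated by X, since B is closed under skew-primitives adjacent to it.
   When X = {a, b} the kernel of Z^2 -> G(B) meets Z(1, -1) trivially, hence embeds
   in Z through (i, j) |-> i + j and is cyclic, generated by some (m, -n). *)
Require Import Defs.
From HB Require Import structures.
From mathcomp Require Import all_boot all_order all_algebra.
From mathcomp Require Import zify boolp classical_sets.
Import Order.TTheory GRing.Theory Num.Theory.
Set Implicit Arguments. Unset Strict Implicit. Unset Printing Implicit Defensive.
Local Open Scope ring_scope.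

(** * Linear functionals separating vectors from subspaces *)

Section Functionals.
Context {K : fieldType}.

Lemma subspaceD (V : lmodType K) (C : V -> Prop) x y :
  subspace C -> C x -> C y -> C (x + y).
Proof. by case=> _ CL Cx Cy; rewrite -[x]scale1r; apply: CL. Qed.

Lemma subspaceZ (V : lmodType K) (C : V -> Prop) a x :
  subspace C -> C x -> C (a *: x).
Proof. by case=> C0 CL Cx; rewrite -[_ *: _]addr0; apply: CL. Qed.

Lemma subspaceB (V : lmodType K) (C : V -> Prop) x y :
  subspace C -> C x -> C y -> C (x - y).
Proof. by move=> CS Cx Cy; apply: subspaceD => //; rewrite -scaleN1r; apply: subspaceZ. Qed.

(** Zorn's lemma gives a subspace [W] maximal among those that contain [C] and avoid [v]. It is a
    complement of the line through [v], and [phi] reads off the coefficient of [v] modulo [W]. *)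
Lemma separating_functional (V : lmodType K) (C : V -> Prop) (v : V) :
  subspace C -> ~ C v ->
  exists phi : {scalar V}, (forall x, C x -> phi x = 0) /\ phi v = 1.
Proof.
move=> CS Cv.
pose admissible (W : V -> Prop) :=
  [/\ subspace W, forall x, C x -> W x & ~ W v].
have [W [WP Wmax]] : exists W : set V, (W = set0 \/ admissible W) /\
    forall W', (W `<` W')%classic -> ~ (W' = set0 \/ admissible W').
  apply: Zorn_bigcup => F FP Ftot.
  have [[W0 FW0 W0ne]|noW] := pselect (exists2 W, F W & W <> set0); last first.
    left; apply/seteqP; split=> // x [W FW Wx].
    by case: noW; exists W => // W0; rewrite W0 in Wx.
  have adm W x : F W -> W x -> admissible W.
    by move=> FW Wx; case: (FP _ FW) => // W0'; rewrite W0' in Wx.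
  have [x0 W0x0] : exists x, W0 x.
    by apply: contrapT => nx; apply: W0ne; apply/seteqP; split=> // x Wx; case: nx; exists x.
  right; split.
  - have [[W00 _] _ _] := adm _ _ FW0 W0x0.
    split; first by exists W0.
    move=> a x y [W1 F1 W1x] [W2 F2 W2y].
    have [sub12|sub21] := Ftot _ _ F1 F2.
      exists W2 => //; have [[_ WL] _ _] := adm _ _ F2 W2y.
      by apply: WL => //; apply: sub12.
    exists W1 => //; have [[_ WL] _ _] := adm _ _ F1 W1x.
    by apply: WL => //; apply: sub21.
  - move=> x Cx; exists W0 => //; have [_ CW _] := adm _ _ FW0 W0x0; exact: CW.
  - by move=> [W FW Wv]; have [_ _] := adm _ _ FW Wv; apply.
have {WP} [WS CW Wv] : admissible W.
  case: WP => // W0.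
  exfalso; apply: (Wmax C); last by right; split.
  split; first by move=> eqWC; rewrite W0.
  by rewrite W0 => /(_ 0 (proj1 CS)).
have decomp x : exists a, W (x - a *: v).
  have [Wx|Wx] := pselect (W x); first by exists 0; rewrite scale0r subr0.
  (* For [x] outside [W], the larger subspace [W + K x] must contain [v]; solving for [x] gives its
     decomposition. *)
  pose W' y := exists b, W (y - b *: x).
  have WW' y : W y -> W' y by move=> Wy; exists 0; rewrite scale0r subr0.
  have W'v : W' v.
    apply: contrapT => nW'v; apply: (Wmax W'); last first.
      right; split=> // [|y Cy]; last by apply/WW'/CW.
      split; first by apply: WW'; case: WS.
      move=> a y z [b Wb] [c Wc]; exists (a * b + c).
      rewrite scalerDl opprD addrACA -scalerA -scalerBr.
      by case: WS => _; apply.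
    split=> // sub; apply: Wx; apply: sub.
    by exists 1; rewrite scale1r subrr; case: WS.
  have [b Wb] := W'v.
  have b0 : b != 0 by apply/eqP => b0; apply: Wv; rewrite b0 scale0r subr0 in Wb.
  exists b^-1; have := subspaceZ (- b^-1) WS Wb.
  by rewrite scalerBr scalerA mulNr mulVf // scaleN1r opprK scaleNr addrC.
have [f fP] := choice decomp.
have funiq x a : W (x - a *: v) -> f x = a.
  move=> Wa; apply/eqP; apply: contrapT => /negP; rewrite -subr_eq0 => nz.
  apply: Wv; have := subspaceB WS Wa (fP x).
  rewrite opprB addrC addrA subrK -scalerBl => /(subspaceZ (f x - a)^-1 WS).
  by rewrite scalerA mulVf // scale1r.
have flin : scalar f.
  move=> a x y; apply: funiq.
  rewrite scalerDl opprD addrACA -scalerA -scalerBr.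
  by case: (WS) => _; apply.
pose phi : {scalar V} := HB.pack f (GRing.isLinear.Build _ _ _ _ f flin).
exists phi; split=> [x Cx|]; apply: funiq.
  by rewrite scale0r subr0; apply: CW.
by rewrite scale1r subrr; case: WS.
Qed.

Lemma bilin_prod (V : lmodType K) (phi chi : {scalar V}) :
  bilin (fun x y => phi x * chi y).
Proof.
split=> a x y z; rewrite linearP.
  by rewrite mulrDl mulrA.
by rewrite mulrDr mulrCA.
Qed.

Lemma bilin0l (V : lmodType K) (f : V -> V -> K) y : bilin f -> f 0 y = 0.
Proof.
by move=> [fl _]; have := fl (-1) 0 0 y; rewrite scaler0 addr0 mulN1r addNr.
Qed.

Lemma bilin0r (V : lmodType K) (f : V -> V -> K) x : bilin f -> f x 0 = 0.
Proof.
by move=> [_ fr]; have := fr (-1) x 0 0; rewrite scaler0 addr0 mulN1r addNr.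
Qed.

Lemma bilinZl (V : lmodType K) (f : V -> V -> K) a x y :
  bilin f -> f (a *: x) y = a * f x y.
Proof.
by move=> fB; rewrite -[a *: x]addr0 fB.1 bilin0l // addr0.
Qed.

(** [teq2] only tests scalar-valued forms; composing [f] with a functional that takes the value 1 on
    the difference of the two sums covers values in any space [W]. *)
Lemma teq2_bilinear (V W : lmodType K) (f : V -> V -> W) (s t : seq (V * V)) :
  (forall a x x' y, f (a *: x + x') y = a *: f x y + f x' y) ->
  (forall a x y y', f x (a *: y + y') = a *: f x y + f x y') ->
  teq2 s t -> \sum_(p <- s) f p.1 p.2 = \sum_(p <- t) f p.1 p.2.
Proof.
move=> fl fr st; apply/eqP; rewrite -subr_eq0; apply/eqP; apply: contrapT => ne.
have S0 : subspace (fun x : W => x = 0).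
  by split=> // a x y -> ->; rewrite scaler0 addr0.
have [phi [_ ]] := separating_functional S0 ne.
rewrite linearB !linear_sum /= => /eqP; apply/negP.
rewrite (st (fun x y => phi (f x y))) ?subrr 1?eq_sym ?oner_eq0 //.
by split=> *; rewrite ?fl ?fr linearP.
Qed.

End Functionals.

(** * Grouplikes and skew-primitives of a coalgebra *)

Section Coalgebra.
Context {K : fieldType} {V : lmodType K} {D : V -> seq (V * V)} {e : V -> K}.
Context (coalgD : is_coalgebra D e).

Lemma comul_linear f a x y : bilin f ->
  \sum_(p <- D (a *: x + y)) f p.1 p.2 =
  a * \sum_(p <- D x) f p.1 p.2 + \sum_(p <- D y) f p.1 p.2.
Proof.
move=> fB; case: (coalgD) => _ [Dlin _]; rewrite (Dlin a x y f fB).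
rewrite big_cat big_map /= mulr_sumr; congr (_ + _); apply: eq_bigr => p _.
exact: bilinZl.
Qed.

Lemma comul0 f : bilin f -> \sum_(p <- D 0) f p.1 p.2 = 0.
Proof.
by move=> fB; have := comul_linear (-1) 0 0 fB; rewrite scaler0 addr0 mulN1r addNr.
Qed.

Lemma counit0 : e 0 = 0.
Proof.
by case: (coalgD) => el _; have := el (-1) 0 0; rewrite scaler0 addr0 mulN1r addNr.
Qed.

Lemma skewprim_form g h x f : bilin f -> skewprim D g h x ->
  \sum_(p <- D x) f p.1 p.2 = f g x + f x h.
Proof. by move=> fB /(_ f fB) ->; rewrite !big_cons big_nil addr0. Qed.

Lemma grouplike_form g f : bilin f -> grouplike D g ->
  \sum_(p <- D g) f p.1 p.2 = f g g.
Proof. by move=> fB [_ /(_ f fB) ->]; rewrite big_seq1. Qed.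

Lemma counit_grouplike g : grouplike D g -> e g = 1.
Proof.
move=> [g0 Dg]; case: (coalgD) => elin [_ [_ [cl _]]].
have := cl g; rewrite (teq2_bilinear (f := fun x y => e x *: y) _ _ Dg).
- rewrite big_seq1 /= => /eqP; rewrite -subr_eq0 -{3}[g]scale1r -scalerBl scaler_eq0.
  by rewrite subr_eq0 => /orP[/eqP //|/eqP].
- by move=> a x x' y; rewrite elin scalerDl scalerA.
- by move=> a x y y'; rewrite scalerDr !scalerA mulrC.
Qed.

(** The left counit axiom applied to [x] reads [x + e x *: h = x], and [h] is nonzero. *)
Lemma counit_skewprim g h x : grouplike D g -> grouplike D h ->
  skewprim D g h x -> e x = 0.
Proof.
move=> Gg [h0 _] Dx; case: (coalgD) => elin [_ [_ [cl _]]].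
have := cl x; rewrite (teq2_bilinear (f := fun x y => e x *: y) _ _ Dx).
- rewrite !big_cons big_nil /= (counit_grouplike Gg) scale1r addr0 => /eqP.
  rewrite -subr_eq0 addrC addrA addNr add0r scaler_eq0.
  by move=> /orP[/eqP //|/eqP].
- by move=> a u x' y; rewrite elin scalerDl scalerA.
- by move=> a u y y'; rewrite scalerDr !scalerA mulrC.
Qed.

Lemma skewprim_linear g h a x y : skewprim D g h x -> skewprim D g h y ->
  skewprim D g h (a *: x + y).
Proof.
move=> Dx Dy f fB; rewrite comul_linear // (skewprim_form fB Dx) (skewprim_form fB Dy).
by rewrite !big_cons big_nil addr0 /= fB.1 fB.2 mulrDr addrACA.
Qed.

Lemma skewprimZ g h a x : skewprim D g h x -> skewprim D g h (a *: x).
Proof.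
move=> Dx; have D0 : skewprim D g h 0.
  move=> f fB; rewrite comul0 // !big_cons big_nil /=.
  by rewrite bilin0l // bilin0r // !addr0.
by have := skewprim_linear a Dx D0; rewrite addr0.
Qed.

Lemma skewprim_trivial g h b : grouplike D g -> grouplike D h ->
  skewprim D g h (b *: (g - h)).
Proof.
move=> Gg Gh; apply: skewprimZ => f fB.
rewrite -[g - h]addrC -scaleN1r comul_linear // !grouplike_form //.
rewrite !big_cons big_nil addr0 /= fB.1 fB.2 !mulN1r.
by rewrite [RHS]addrC addrA addrK.
Qed.

(* Applied to functionals [phi1], [phi2] vanishing on [C1], [C2] and equal to 1
   at [k], the form [phi1 (x) phi2] kills [Delta w] but not [Delta k]. *)
Lemma grouplike_wedge (W C1 C2 : V -> Prop) k :
  subspace C1 -> subspace C2 -> grouplike D k -> W k ->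
  (forall w, W w -> exists s, teq2 (D w) s /\
     forall p, p \in s -> C1 p.1 \/ C2 p.2) ->
  C1 k \/ C2 k.
Proof.
move=> S1 S2 Gk Wk WD.
apply: contrapT => /not_orP[/(separating_functional S1)[phi1 [z1 one1]]].
move=> /(separating_functional S2)[phi2 [z2 one2]].
have fB := bilin_prod phi1 phi2.
have [s [Ds sC]] := WD _ Wk.
have := grouplike_form fB Gk; rewrite (Ds _ fB) one1 one2 mulr1.
rewrite big_seq big1 => [/esym/eqP|p ps]; first by rewrite oner_eq0.
by case: (sC _ ps) => [/z1|/z2] ->; rewrite ?mul0r ?mulr0.
Qed.

End Coalgebra.

(** * Comodules as matrices, and their homomorphisms *)

Section Comodules.
Context {K : fieldType} {H : algType K} {D : H -> seq (H * H)} {e : H -> K}.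

Local Notation "F %:AM" := (map_mx (in_alg H) F) (at level 2, format "F %:AM").

(** Embedding scalar matrices in matrices over [H] turns the condition in [comod_iso] into a matrix
    identity, so that homomorphisms compose and invert by matrix algebra. *)
Lemma comod_homE (n : nat) (c c' : 'M[H]_n) (P : 'M[K]_n) :
  (forall i j, \sum_k P i k *: c k j = \sum_k P k j *: c' i k) <->
  P%:AM *m c = c' *m P%:AM.
Proof.
have entries i j : (P%:AM *m c) i j = \sum_k P i k *: c k j /\
    (c' *m P%:AM) i j = \sum_k P k j *: c' i k.
  rewrite !mxE; split; apply: eq_bigr => k _; rewrite mxE.
    by rewrite mulr_algl.
  by rewrite mulr_algr.
split=> [eqP|eqP i j]; first by apply/matrixP => i j; rewrite (entries i j).1 (entries i j).2.
by rewrite -(entries i j).1 -(entries i j).2 eqP.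
Qed.

Lemma comod_hom_inv (n : nat) (c c' : 'M[H]_n) (P : 'M[K]_n) : P \in unitmx ->
  P%:AM *m c = c' *m P%:AM -> (invmx P)%:AM *m c' = c *m (invmx P)%:AM.
Proof.
move=> uP hP; rewrite -[c' in LHS]mulmx1 -(map_mx1 (in_alg H)) -(mulmxV uP) map_mxM.
by rewrite !mulmxA -(mulmxA _ c') -hP mulmxA -map_mxM mulVmx // map_mx1 mul1mx.
Qed.

Lemma comod_iso_refl (n : nat) (c : 'M[H]_n) : comod_iso c c.
Proof.
by exists 1%:M; rewrite unitmx1; split=> //; apply/comod_homE; rewrite map_mx1 mul1mx mulmx1.
Qed.

Lemma comod_iso_sym (n : nat) (c c' : 'M[H]_n) : comod_iso c c' -> comod_iso c' c.
Proof.
move=> [P [uP /comod_homE hP]]; exists (invmx P); rewrite unitmx_inv; split=> //.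
by apply/comod_homE; apply: comod_hom_inv.
Qed.

Lemma comod_iso_trans (n : nat) (c1 c2 c3 : 'M[H]_n) :
  comod_iso c1 c2 -> comod_iso c2 c3 -> comod_iso c1 c3.
Proof.
move=> [P [uP /comod_homE hP]] [Q [uQ /comod_homE hQ]]; exists (Q *m P).
rewrite unitmx_mul uQ uP; split=> //.
by apply/comod_homE; rewrite map_mxM -mulmxA hP mulmxA hQ mulmxA.
Qed.

(** A splitting of [c] yields an idempotent endomorphism other than 0 and 1, namely a conjugate of a
    coordinate projector. *)
Lemma indecomposable_idempotents (n : nat) (c : 'M[H]_n) :
  (0 < n)%N ->
  (forall F : 'M[K]_n, F *m F = F -> F%:AM *m c = c *m F%:AM ->
     F = 0 \/ F = 1%:M) ->
  indecomposable c.
Proof.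
move=> n_gt0 idem; split=> // -[c' [n1 [[P [uP /comod_homE hP]] [/andP[n1_gt0 n1_lt] zc]]]].
(* Projector onto the first [n1] basis vectors; it commutes with [c'] because the entries of [c']
   joining the two blocks vanish. *)
pose E : 'M[K]_n := \matrix_(i, j) ((i == j) && (i < n1)%N)%:R.
have EE : E *m E = E.
  apply/matrixP => i j; rewrite !mxE (bigD1 i) //= !mxE eqxx /= big1 => [|k ki].
    by rewrite addr0; case: (i < n1)%N; rewrite ?mul1r ?mul0r ?andbF.
  by rewrite !mxE eq_sym (negPf ki) mul0r.
have Ec : E%:AM *m c' = c' *m E%:AM.
  apply/matrixP => i j; rewrite !mxE [LHS](bigD1 i) //= [RHS](bigD1 j) //= !mxE !eqxx /=.
  rewrite !big1 => [|k kj|k ki]; last 2 first.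
  - by rewrite !mxE (negPf kj) /= scale0r mulr0.
  - by rewrite !mxE eq_sym (negPf ki) /= scale0r mul0r.
  rewrite !addr0 mulr_algl mulr_algr.
  have [->//|ne] := eqVneq (i < n1)%N (j < n1)%N.
  by rewrite zc // !scaler0.
have FF : (invmx P *m E *m P) *m (invmx P *m E *m P) = invmx P *m E *m P.
  by rewrite !mulmxA mulmxK // -(mulmxA _ E E) EE.
have Fc : (invmx P *m E *m P)%:AM *m c = c *m (invmx P *m E *m P)%:AM.
  rewrite !map_mxM -!mulmxA hP (mulmxA _ c') Ec.
  by rewrite !mulmxA (comod_hom_inv uP hP).
have EF : E = P *m (invmx P *m E *m P) *m invmx P.
  by rewrite !mulmxA mulmxV // mul1mx mulmxK.
case: (idem _ FF Fc) => F0; move: EF; rewrite F0.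
  rewrite mulmx0 mul0mx => /matrixP/(_ (Ordinal n_gt0) (Ordinal n_gt0)) /eqP.
  by rewrite !mxE eqxx n1_gt0 oner_eq0.
rewrite mulmx1 mulmxV // => /matrixP/(_ (Ordinal n1_lt) (Ordinal n1_lt)) /eqP.
by rewrite !mxE eqxx ltnn eq_sym oner_eq0.
Qed.

(** * A one-parameter family of comodules on an alternating cycle of arrows *)

Section CycleComodule.
Context (N : nat) (g h x y : 'I_N.+1 -> H).

(** Only the arrow [y] out of the last source carries the parameter: rescaling basis vectors can
    normalise the others, and what remains is the invariant of the cycle. *)
Definition cycle_weight (lam : K) (i : 'I_N.+1) : K :=
  if i == ord_max then lam else 1.

(** The two terms are added rather than chosen by cases, since for [N = 0] one has [ordS i = i] and
    the single entry has to be [x i + lam *: y i]. *)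
Definition cycle_block (lam : K) : 'M[H]_N.+1 :=
  \matrix_(i, j) ((j == i)%:R *: x i + ((j == ordS i)%:R * cycle_weight lam i) *: y i).

Definition cycle_comod (lam : K) : 'M[H]_(N.+1 + N.+1) :=
  block_mx (diag_mx (\row_i g i)) (cycle_block lam) 0 (diag_mx (\row_i h i)).

Context (coalgD : is_coalgebra D e).
Context (gG : forall i, grouplike D (g i)) (hG : forall i, grouplike D (h i)).
Context (xP : forall i, skewprim D (g i) (h i) (x i)).
Context (yP : forall i, skewprim D (g i) (h (ordS i)) (y i)).

Lemma cycle_block_skewprim lam i j : skewprim D (g i) (h j) (cycle_block lam i j).
Proof.
have scl k z (P : bool) : (P -> skewprim D (g i) (h j) z) ->
    skewprim D (g i) (h j) ((P%:R * k) *: z).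
  case: P => [/(_ isT) zP|_]; first by apply: (skewprimZ coalgD).
  rewrite mul0r scale0r -(scale0r (g i - h j)).
  exact: (skewprim_trivial coalgD).
rewrite mxE -[(j == i)%:R]mulr1 -[_ *: x i]scale1r.
apply: (skewprim_linear coalgD); apply: scl => /eqP -> //.
Qed.

(** Blockwise, the coproduct rule is the grouplike law on the diagonal and the skew-primitive law in
    the upper right block. *)
Lemma cycle_comodP lam : comod D e (cycle_comod lam).
Proof.
have dl (f : H -> H -> K) d (M : 'M[H]_N.+1) i j : bilin f ->
    \sum_k f (diag_mx (\row_i d i) i k) (M k j) = f (d i) (M i j).
  move=> fB; rewrite (bigD1 i) //= !mxE eqxx mulr1n big1 ?addr0 // => k ki.
  rewrite !mxE eq_sym (negPf ki) mulr0n.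
  exact: bilin0l.
have dr (f : H -> H -> K) d (M : 'M[H]_N.+1) i j : bilin f ->
    \sum_k f (M i k) (diag_mx (\row_i d i) k j) = f (M i j) (d j).
  move=> fB; rewrite (bigD1 j) //= !mxE eqxx mulr1n big1 ?addr0 // => k kj.
  rewrite !mxE (negPf kj) mulr0n.
  exact: bilin0r.
have e0 := counit0 coalgD.
have zE (i j : 'I_N.+1) : (0 : 'M[H]_N.+1) i j = 0 by rewrite mxE.
split=> i j; last first.
  case: (split_ordP i) => i' ->; case: (split_ordP j) => j' ->;
  rewrite /cycle_comod ?block_mxEul ?block_mxEur ?block_mxEdl ?block_mxEdr
    ?eq_lshift ?eq_rshift ?eq_lrshift ?eq_rlshift.
  - rewrite !mxE; case: eqP => _; last by rewrite mulr0n e0.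
    by rewrite mulr1n (counit_grouplike coalgD).
  - exact: (counit_skewprim coalgD (gG i') (hG j') (cycle_block_skewprim lam i' j')).
  - by rewrite mxE e0.
  - rewrite !mxE; case: eqP => _; last by rewrite mulr0n e0.
    by rewrite mulr1n (counit_grouplike coalgD).
move=> f fB; rewrite big_map big_enum /= big_split_ord /=.
case: (split_ordP i) => i' ->; case: (split_ordP j) => j' ->.
- under [X in _ = X + _]eq_bigr do rewrite /cycle_comod !block_mxEul.
  under [X in _ = _ + X]eq_bigr do rewrite /cycle_comod block_mxEdl zE (bilin0r _ fB).
  rewrite big1_eq addr0 dl // /cycle_comod block_mxEul !mxE.
  case: eqP => [->|_]; last by rewrite mulr0n (comul0 coalgD) // bilin0r.
  by rewrite !mulr1n (grouplike_form fB).
- under [X in _ = X + _]eq_bigr do rewrite /cycle_comod block_mxEul block_mxEur.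
  under [X in _ = _ + X]eq_bigr do rewrite /cycle_comod block_mxEdr block_mxEur.
  rewrite dl // dr // /cycle_comod block_mxEur.
  by rewrite (skewprim_form fB (cycle_block_skewprim lam i' j')).
- under [X in _ = X + _]eq_bigr do rewrite /cycle_comod block_mxEdl zE (bilin0l _ fB).
  under [X in _ = _ + X]eq_bigr do rewrite /cycle_comod [X in f _ X]block_mxEdl zE (bilin0r _ fB).
  by rewrite !big1_eq addr0 /cycle_comod block_mxEdl zE (comul0 coalgD).
- under [X in _ = X + _]eq_bigr do rewrite /cycle_comod block_mxEdl zE (bilin0l _ fB).
  under [X in _ = _ + X]eq_bigr do rewrite /cycle_comod !block_mxEdr.
  rewrite big1_eq add0r dl // /cycle_comod block_mxEdr !mxE.
  case: eqP => [->|_]; last by rewrite mulr0n (comul0 coalgD) // bilin0r.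
  by rewrite !mulr1n (grouplike_form fB).
Qed.

Context (g_inj : injective g) (h_inj : injective h).
(** For [N > 0] an entry involves at most one of [x i] and [y i], so this says that each is
    nontrivial; for [N = 0] it is joint independence modulo [g - h]. *)
Context (indep : forall i j (a b c : K),
  ((j == i)%:R * a) *: x i + ((j == ordS i)%:R * b) *: y i = c *: (g i - h j) ->
  (j = i -> a = 0) /\ (j = ordS i -> b = 0)).

(** In block form the lower left block vanishes, injectivity of [g] and [h] makes the diagonal
    blocks diagonal, and the upper right block identity propagates a single scalar around the
    cycle. *)
Lemma cycle_comod_hom lam mu (F : 'M[K]_(N.+1 + N.+1)) :
  F%:AM *m cycle_comod lam = cycle_comod mu *m F%:AM ->
  exists2 p : K, p * lam = p * mu & exists Z, F = block_mx p%:M Z 0 p%:M.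
Proof.
rewrite -(submxK F); move: (ulsubmx F) (ursubmx F) (dlsubmx F) (drsubmx F) => A Z C B.
rewrite map_block_mx /cycle_comod !mulmx_block.
rewrite !mulmx0 !mul0mx !addr0 !add0r => /eq_block_mx[e11 e12 e21 e22].
(* A nonzero [C k j] forces [g j = h k]. By injectivity of [h] one term then survives in the
   [(k, j)] entry of [e11], making a nonzero multiple of [cycle_block mu k k] a multiple of
   [g k - h k], against [indep]. *)
have C0 : C = 0.
  have gh i j : C i j != 0 -> g j = h i.
    move=> Cij; move/matrixP/(_ i j): e21; rewrite mul_mx_diag mul_diag_mx !mxE.
    by rewrite mulr_algl mulr_algr => /(scalerI Cij).
  apply/matrixP => k j; rewrite mxE; apply/eqP; apply: contraT => Ckj.
  move/matrixP/(_ k j): e11; rewrite mul_mx_diag mul_diag_mx !mxE mulr_algl mulr_algr.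
  rewrite (bigD1 k) //= !mxE big1 => [|l lk]; last first.
    rewrite [X in _ * X]mxE; have [->|/gh] := eqVneq (C l j) 0; first by rewrite /= scale0r mulr0.
    by rewrite (gh k j) // => /h_inj kl; rewrite kl eqxx in lk.
  rewrite addr0 mulr_algr (gh k j) // => eqA.
  have [|/(_ erefl) C0 _] := @indep k k (C k j) (C k j * cycle_weight mu k) (- A k j); last first.
    by rewrite C0 eqxx in Ckj.
  rewrite scaleNr -scalerN opprB scalerBr eqA addrAC subrr add0r scalerDr !scalerA.
  by rewrite [_%:R * C k j]mulrC mulrCA.
rewrite C0 map_mx0 ?mulmx0 ?mul0mx ?addr0 ?add0r in e11 e22 *.
have Adiag i j : i != j -> A i j = 0.
  move/matrixP/(_ i j): e11; rewrite mul_mx_diag mul_diag_mx !mxE mulr_algl mulr_algr.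
  by have [//|Aij /(scalerI Aij)/g_inj ->] := eqVneq (A i j) 0; rewrite eqxx.
have Bdiag i j : i != j -> B i j = 0.
  move/matrixP/(_ i j): e22; rewrite mul_mx_diag mul_diag_mx !mxE mulr_algl mulr_algr.
  by have [//|Bij /(scalerI Bij)/h_inj ->] := eqVneq (B i j) 0; rewrite eqxx.
(* The [(i, j)] entry of [e12] equates a combination of [x i] and [y i] with [Z i j *: (g i - h j)],
   so [indep] applies to its coefficients. *)
have ABij i j : (j = i -> A i i - B j j = 0) /\
    (j = ordS i -> A i i * cycle_weight lam i - B j j * cycle_weight mu i = 0).
  apply: (@indep i j _ _ (Z i j)).
  move/matrixP/(_ i j): e12; rewrite mul_mx_diag mul_diag_mx !mxE mulr_algl mulr_algr.
  rewrite [in LHS](bigD1 i) //= [in RHS](bigD1 j) //= !mxE !big1 => [|k kj|k ki]; last 2 first.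
  - by rewrite [X in _ * X]mxE Bdiag //= scale0r mulr0.
  - by rewrite mxE Adiag 1?eq_sym //= scale0r mul0r.
  rewrite !addr0 mulr_algl mulr_algr => eqZ.
  have -> : Z i j *: (g i - h j) = A i i *: cycle_block lam i j - B j j *: cycle_block mu i j.
    rewrite !mxE scalerBr; apply/eqP; rewrite subr_eq addrAC eq_sym subr_eq; apply/eqP.
    exact: eqZ.
  rewrite !mxE !scalerDr !scalerA opprD addrACA -!scalerBl.
  by rewrite !mulrBr ![(j == i)%:R * _]mulrC ![(j == ordS i)%:R * (_ * _)]mulrCA.
have AB i : B i i = A i i.
  by apply/esym/eqP; rewrite -subr_eq0 ((ABij i i).1 erefl).
have AS i : A i i * cycle_weight lam i = A (ordS i) (ordS i) * cycle_weight mu i.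
  by apply/eqP; rewrite -subr_eq0 -AB -AB AB ((ABij i (ordS i)).2 erefl).
(* The weights are 1 except at [ord_max], so the scalar is carried along from index 0; the last
   arrow then gives [p * lam = p * mu]. *)
have A00 i : A i i = A ord0 ord0.
  case: i => k; elim: k => [|k IH] kN; first by congr (A _ _); apply: val_inj.
  have kN' := ltnW kN; rewrite -(IH kN').
  have := AS (Ordinal kN'); rewrite /cycle_weight -val_eqE /= ltn_eqF //.
  rewrite !mulr1 => ->; congr (A _ _); apply: val_inj => /=; by rewrite modn_small.
exists (A ord0 ord0).
  have := AS ord_max; rewrite !A00 /cycle_weight eqxx => ->.
  by [].
exists Z; congr (block_mx _ _ _ _); apply/matrixP => i j; rewrite mxE.
  by have [->|/Adiag ->] := eqVneq i j; rewrite ?A00 ?mulr1n ?mulr0n.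
by have [->|/Bdiag ->] := eqVneq i j; rewrite ?AB ?A00 ?mulr1n ?mulr0n.
Qed.

(** An endomorphism is a scalar [p] plus a square-zero block; if it is idempotent, then [p] is 0 or
    1 and the block vanishes. *)
Lemma cycle_comod_indecomposable lam : indecomposable (cycle_comod lam).
Proof.
apply: indecomposable_idempotents => // F FF /cycle_comod_hom[p _ [Z EF]].
move: FF; rewrite EF mulmx_block !mulmx0 !mul0mx addr0 add0r => /eq_block_mx[pp ZZ _ _].
have /eqP : p * p = p.
  by move/matrixP/(_ ord0 ord0): pp; rewrite -scalar_mxM !mxE !mulr1n.
rewrite -subr_eq0 -{3}[p]mulr1 -mulrBr mulf_eq0 subr_eq0 => /orP[]/eqP p01; [left|right].
  by move: ZZ; rewrite p01 -scalemx1 scale0r mul0mx mulmx0 addr0 => <-; rewrite block_mx0.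
move: ZZ; rewrite p01 mul1mx mulmx1 => /eqP; rewrite -subr_eq0 addrK => /eqP ->.
by rewrite -scalar_mx_block.
Qed.

(** With [p = 0] the isomorphism would be square-zero; hence [p] cancels in [p * lam = p * mu]. *)
Lemma cycle_comod_iso lam mu :
  comod_iso (cycle_comod lam) (cycle_comod mu) -> lam = mu.
Proof.
move=> [P [uP /comod_homE/cycle_comod_hom[p plm [Z EP]]]].
have [p0|p0] := eqVneq p 0; last exact: (mulfI p0).
have PP : P *m P = 0.
  by rewrite EP p0 -scalemx1 scale0r mulmx_block !mulmx0 !mul0mx addr0 block_mx0.
have := mulKmx uP P; rewrite PP mulmx0 => P0.
have := mulVmx uP; rewrite -P0 mulmx0 => /matrixP/(_ (lshift _ ord0) (lshift _ ord0))/eqP.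
by rewrite !mxE eqxx eq_sym oner_eq0.
Qed.

(** The comodule is already triangular and its diagonal does not involve [lam], so [lam = 0] serves
    as reference for the whole family. *)
Lemma cycle_comod_dimvec lam :
  dimvec (cycle_comod lam) (fun v => #|[set i | cycle_comod 0 i i == v]|).
Proof.
exists (cycle_comod lam); split; first exact: comod_iso_refl.
split=> [i j|v].
  case: (split_ordP i) => i' ->; case: (split_ordP j) => j' ->;
  rewrite /cycle_comod ?block_mxEul ?block_mxEur ?block_mxEdl ?block_mxEdr /= => ij.
  - by rewrite !mxE -val_eqE gtn_eqF.
  - by move: ij; rewrite ltnNge (leq_trans (ltnW (ltn_ord i'))) ?leq_addr.
  - by rewrite mxE.
  - by rewrite ltn_add2l in ij; rewrite !mxE -val_eqE gtn_eqF.
apply: eq_card => i; rewrite !inE; congr (_ == _).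
by case: (split_ordP i) => i' ->; rewrite /cycle_comod ?block_mxEul ?block_mxEdr.
Qed.

(** A finite list of representatives would receive an injective map from the infinite field [K],
    sending [lam] to the representative of [cycle_comod lam]. *)
Lemma cycle_not_discrete : (forall s : seq K, exists a, a \notin s) ->
  ~ discrete_corep D e.
Proof.
move=> Kinf disc.
have [s sP] := disc (N.+1 + N.+1)%N (fun v => #|[set i | cycle_comod 0 i i == v]|).
have exf lam : exists c', c' \in s /\ comod_iso (cycle_comod lam) c'.
  apply: sP; [exact: cycle_comodP | exact: cycle_comod_indecomposable
             | exact: cycle_comod_dimvec].
have [f fP] := choice exf.
have f_inj : injective f.
  move=> lam mu fE; apply: cycle_comod_iso.
  by apply: comod_iso_trans (fP lam).2 _; rewrite fE; apply/comod_iso_sym/(fP mu).2.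
have [t tu ts] : exists2 t : seq K, uniq t & size t = (size s).+1.
  elim: (size s).+1 => [|n [t tu <-]]; first by exists [::].
  by have [a at_] := Kinf t; exists (a :: t); rewrite //= at_.
have ft_uniq : uniq (map f t) by rewrite map_inj_uniq.
have ft_sub : {subset map f t <= s} by move=> c /mapP[lam _ ->]; case: (fP lam).
by have := uniq_leq_size ft_uniq ft_sub; rewrite size_map ts ltnn.
Qed.

End CycleComodule.
End Comodules.

(** * Grouplikes of a Hopf algebra and translation of arrows *)

Section HopfGrouplikes.
Context {K : fieldType} {H : algType K} {D : H -> seq (H * H)} {e : H -> K} {S : H -> H}.
Context (hopfD : is_hopf D e S).

Local Notation arrow := (has_arrow D (fun _ => True)).

Let coalgD : is_coalgebra D e. Proof. by case: hopfD. Qed.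

Lemma bilin_mull (f : H -> H -> K) k l : bilin f -> bilin (fun u v => f (k * u) (l * v)).
Proof. by move=> fB; split=> *; rewrite mulrDr -scalerAr; case: fB => fl fr; rewrite ?fl ?fr. Qed.

Lemma bilin_mulr (f : H -> H -> K) k l : bilin f -> bilin (fun u v => f (u * k) (v * l)).
Proof. by move=> fB; split=> *; rewrite mulrDl -scalerAl; case: fB => fl fr; rewrite ?fl ?fr. Qed.

Lemma comulM f x y : bilin f -> \sum_(p <- D (x * y)) f p.1 p.2 =
  \sum_(p <- D x) \sum_(q <- D y) f (p.1 * q.1) (p.2 * q.2).
Proof.
move=> fB; case: hopfD => _ [/(_ x y f fB) -> _]; rewrite big_flatten big_map.
by apply: eq_bigr => p _; rewrite big_map.
Qed.

Lemma comul_grouplike_mull f k y : bilin f -> grouplike D k ->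
  \sum_(p <- D (k * y)) f p.1 p.2 = \sum_(q <- D y) f (k * q.1) (k * q.2).
Proof.
move=> fB Gk; rewrite comulM // exchange_big; apply: eq_bigr => q _.
exact: (grouplike_form (bilin_mulr q.1 q.2 fB) Gk).
Qed.

Lemma comul_grouplike_mulr f k y : bilin f -> grouplike D k ->
  \sum_(p <- D (y * k)) f p.1 p.2 = \sum_(q <- D y) f (q.1 * k) (q.2 * k).
Proof.
move=> fB Gk; rewrite comulM //; apply: eq_bigr => q _.
exact: (grouplike_form (bilin_mull q.1 q.2 fB) Gk).
Qed.

Lemma skewprim_mull k g h x : grouplike D k -> skewprim D g h x ->
  skewprim D (k * g) (k * h) (k * x).
Proof.
move=> Gk Dx f fB; rewrite comul_grouplike_mull //.
by rewrite (skewprim_form (bilin_mull k k fB) Dx) !big_cons big_nil addr0.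
Qed.

Lemma skewprim_mulr k g h x : grouplike D k -> skewprim D g h x ->
  skewprim D (g * k) (h * k) (x * k).
Proof.
move=> Gk Dx f fB; rewrite comul_grouplike_mulr //.
by rewrite (skewprim_form (bilin_mulr k k fB) Dx) !big_cons big_nil addr0.
Qed.

Lemma antipode_linear : linear S.
Proof. by case: hopfD => _ [_ [_ [_ [_ [SL _]]]]]. Qed.

Lemma antipode_mull g : grouplike D g -> S g * g = 1.
Proof.
move=> Gg; case: (hopfD) => _ [_ [_ [_ [_ [_ [/(_ g) + _]]]]]].
rewrite (teq2_bilinear (f := fun x y => S x * y) _ _ (proj2 Gg)).
- by rewrite big_seq1 (counit_grouplike coalgD) // scale1r.
- by move=> a x x' y; rewrite antipode_linear mulrDl scalerAl.
- by move=> a x y y'; rewrite mulrDr scalerAr.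
Qed.

Lemma antipode_mulr g : grouplike D g -> g * S g = 1.
Proof.
move=> Gg; case: (hopfD) => _ [_ [_ [_ [_ [_ [_ /(_ g)]]]]]].
rewrite (teq2_bilinear (f := fun x y => x * S y) _ _ (proj2 Gg)).
- by rewrite big_seq1 (counit_grouplike coalgD) // scale1r.
- by move=> a x x' y; rewrite mulrDl scalerAl.
- by move=> a x y y'; rewrite antipode_linear mulrDr scalerAr.
Qed.

Lemma mulgS g x : grouplike D g -> x * g * S g = x.
Proof. by move=> Gg; rewrite -mulrA antipode_mulr // mulr1. Qed.

Lemma mulSg g x : grouplike D g -> x * S g * g = x.
Proof. by move=> Gg; rewrite -mulrA antipode_mull // mulr1. Qed.


Lemma mulg_injr g x y : grouplike D g -> x * g = y * g -> x = y.
Proof. by move=> Gg xy; rewrite -(mulgS x Gg) xy mulgS. Qed.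

Lemma mulg_injl g x y : grouplike D g -> g * x = g * y -> x = y.
Proof.
by move=> Gg xy; rewrite -[x]mul1r -(antipode_mull Gg) -mulrA xy mulrA antipode_mull // mul1r.
Qed.

Lemma grouplike1 : grouplike D 1.
Proof. by split; [apply/eqP/oner_neq0|case: hopfD => _ [_ [D1 _]]]. Qed.

Lemma grouplikeM g h : grouplike D g -> grouplike D h -> grouplike D (g * h).
Proof.
move=> Gg Gh; split=> [gh0|f fB].
  by case: Gh => h0 _; apply: h0; apply: (mulg_injl Gg); rewrite gh0 mulr0.
by rewrite comul_grouplike_mull // (grouplike_form (bilin_mull g g fB) Gh) big_seq1.
Qed.

Lemma grouplikeS g : grouplike D g -> grouplike D (S g).
Proof.
move=> Gg; split=> [Sg0|f fB].
  by have := antipode_mull Gg; rewrite Sg0 mul0r => /esym/eqP; rewrite oner_eq0.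
have fB' := bilin_mull (S g) (S g) fB.
(* The form [f] translated by [S g] is evaluated on the coproduct of [1 = g * S g]; the factors
   [S g * g] cancel. *)
have := grouplike_form fB' grouplike1; rewrite big_seq1 !mulr1 => <-.
rewrite -(antipode_mulr Gg) (comul_grouplike_mull _ fB' Gg).
by apply: eq_bigr => p _; rewrite !mulrA antipode_mull // !mul1r.
Qed.

Lemma grouplikeX g n : grouplike D g -> grouplike D (g ^+ n).
Proof.
move=> Gg; elim: n => [|n IH]; first exact: grouplike1.
by rewrite exprS; apply: grouplikeM.
Qed.

Lemma arrow_mull k g h : grouplike D k -> arrow g h -> arrow (k * g) (k * h).
Proof.
move=> Gk [x [_ [Dx nx]]]; exists (k * x); split=> //.
split=> [|b]; first exact: skewprim_mull.
by rewrite -mulrBr scalerAr => /(mulg_injl Gk)/nx.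
Qed.

Lemma arrow_mulr k g h : grouplike D k -> arrow g h -> arrow (g * k) (h * k).
Proof.
move=> Gk [x [_ [Dx nx]]]; exists (x * k); split=> //.
split=> [|b]; first exact: skewprim_mulr.
by rewrite -mulrBl scalerAl => /(mulg_injr Gk)/nx.
Qed.

Lemma arrow_from k a : grouplike D k -> arrow 1 a -> arrow k (k * a).
Proof. by move=> Gk /(arrow_mull Gk); rewrite mulr1. Qed.

Lemma arrow_quotient g h : grouplike D g -> arrow g h -> arrow 1 (S g * h).
Proof. by move=> Gg /(arrow_mull (grouplikeS Gg)); rewrite antipode_mull. Qed.

Lemma arrow_conj k a : grouplike D k -> arrow 1 a -> arrow 1 (k * a * S k).
Proof.
move=> Gk /(arrow_mull Gk)/(arrow_mulr (grouplikeS Gk)).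
by rewrite mulr1 antipode_mulr.
Qed.

(** * Restrictions on arrows forced by discreteness *)

Section Discrete.
Context (Kinf : forall s : seq K, exists a, a \notin s) (discD : discrete_corep D e).

(** The cycle of length one: skew-primitives [x], [y] independent modulo [g - h] would give the
    infinite family with corner [x + lam *: y]. *)
Lemma skewprim_space_dim1 g h x y : grouplike D g -> grouplike D h ->
  skewprim D g h x -> (forall b, x <> b *: (g - h)) -> skewprim D g h y ->
  exists c b, y = c *: x + b *: (g - h).
Proof.
move=> Gg Gh Dx nx Dy; apply: contrapT => ny.
apply: (@cycle_not_discrete _ _ _ _ 0 (fun=> g) (fun=> h) (fun=> x) (fun=> y)
  coalgD _ _ _ _ _ _ _ Kinf discD) => //.
- by move=> i j _; rewrite !ord1.
- by move=> i j _; rewrite !ord1.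
move=> i j a b c; rewrite (ord1 i) (ord1 j) (ord1 (ordS ord0)) eqxx !mul1r => eqc.
have [b0|b0] := eqVneq b 0; last first.
  case: ny; exists (- (b^-1 * a)), (b^-1 * c).
  by rewrite -[b^-1 * c *: _]scalerA -eqc scalerDr !scalerA mulVf // scale1r scaleNr addKr.
have [a0|a0] := eqVneq a 0; first by [].
case: (nx (a^-1 * c)); rewrite -scalerA -eqc b0 scale0r addr0 scalerA mulVf //.
by rewrite scale1r.
Qed.

(** With [N] at least 2, an index and its cyclic successor differ, so nontriviality of each arrow is
    all the independence that the cycle comodules require. *)
Lemma no_arrow_cycle N (g h : nat -> H) : (1 < N)%N ->
  (forall i, (i < N)%N -> grouplike D (g i)) ->
  (forall i, (i < N)%N -> grouplike D (h i)) ->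
  (forall i j, (i < j < N)%N -> g i <> g j) ->
  (forall i j, (i < j < N)%N -> h i <> h j) ->
  (forall i, (i < N)%N -> arrow (g i) (h i) /\ arrow (g i) (h (i.+1 %% N)%N)) ->
  False.
Proof.
case: N => [|[|N]] // _ Gg Gh g_neq h_neq arr.
have inj (k : nat -> H) : (forall i j, (i < j < N.+2)%N -> k i <> k j) ->
    injective (fun i : 'I_N.+2 => k i).
  move=> kne i j kij; apply: val_inj => /=.
  case: (ltngtP i j) => // ij; first by case: (kne i j _ kij); rewrite ij /=.
  by case: (kne j i _ (esym kij)); rewrite ij /=.
have exx (i : 'I_N.+2) : exists x, skewprim D (g i) (h i) x /\ forall b, x <> b *: (g i - h i).
  by have [[x [_ Dx]] _] := arr i (ltn_ord i); exists x.
have exy (i : 'I_N.+2) : exists y, skewprim D (g i) (h (ordS i)) y /\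
    forall b, y <> b *: (g i - h (ordS i)).
  by have [_ [y [_ Dy]]] := arr i (ltn_ord i); exists y.
have [x xP] := choice exx; have [y yP] := choice exy.
have scl a b (z w : H) : a *: z = b *: w -> (forall c, z <> c *: w) -> a = 0.
  move=> zw nz; have [//|a0] := eqVneq a 0.
  by case: (nz (a^-1 * b)); rewrite -scalerA -zw scalerA mulVf // scale1r.
apply: (@cycle_not_discrete _ _ _ _ N.+1 (fun i => g i) (fun i => h i) x y
  coalgD _ _ _ _ _ _ _ Kinf discD).
- by move=> i; apply: Gg.
- by move=> i; apply: Gh.
- by move=> i; case: (xP i).
- by move=> i; case: (yP i).
- exact: inj.
- exact: inj.
move=> i j a b c eqc.
have Si : ordS i != i.
  rewrite -val_eqE /=; have := ltn_ord i; rewrite leq_eqVlt => /orP[/eqP iN|iN].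
    by rewrite iN modnn; case: iN => ->.
  by rewrite modn_small // gtn_eqF.
split=> ji; move: eqc; rewrite ji eqxx mul1r.
  rewrite eq_sym (negPf Si) mul0r scale0r addr0 => /scl; apply; exact: (xP i).2.
rewrite (negPf Si) mul0r scale0r add0r => /scl; apply; exact: (yP i).2.
Qed.

(* With [c = a b a^-1] and [d = b a b^-1], the identity [d a^-1 c = b] closes the
   cycle [1 -> d <- d a^-1 -> b <- 1]. *)
Lemma arrow_targets_comm a b : grouplike D a -> grouplike D b ->
  arrow 1 a -> arrow 1 b -> a * b = b * a.
Proof.
move=> Ga Gb aa ab; apply: contrapT => nab.
pose d := b * a * S b; pose s := d * S a.
have Gd : grouplike D d by apply: grouplikeM (grouplikeM _ _) (grouplikeS _).
have Gs : grouplike D s by apply: grouplikeM (grouplikeS _).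
have sb : s * (a * b * S a) = b by rewrite /s /d !mulrA (mulSg _ Ga) (mulSg _ Gb) (mulgS _ Ga).
have ad : arrow 1 d by apply: arrow_conj.
apply: (@no_arrow_cycle 2 (nth 1 [:: 1; s]) (nth 1 [:: d; b])) => //.
- by case=> [|[|]] // _; apply: grouplike1.
- by case=> [|[|]].
- move=> i j ij; have [-> ->] : i = 0%N /\ j = 1%N by lia.
  rewrite /= => s1; apply: nab.
  have da : d = a by rewrite -[d](mulSg _ Ga) -/s -s1 mul1r.
  by rewrite -[b * a](mulSg _ Gb) -/d da.
- move=> i j ij; have [-> ->] : i = 0%N /\ j = 1%N by lia.
  rewrite /= => db; apply: nab.
  have : b * a = b * b by rewrite -[b * a](mulSg _ Gb) -/d db.
  by move/(mulg_injl Gb) ->.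
case=> [|[|]] //= _; split=> //.
  by rewrite -[X in arrow _ X]sb; apply: arrow_from => //; apply: arrow_conj.
by rewrite -[X in arrow _ X](mulSg d Ga); apply: arrow_from.
Qed.

(* Otherwise the hexagon [1 -> a <- a c^-1 -> a b c^-1 <- b c^-1 -> b <- 1] is a cycle. *)
Lemma arrow_targets_le2 a b c :
  grouplike D a -> grouplike D b -> grouplike D c ->
  arrow 1 a -> arrow 1 b -> arrow 1 c -> [\/ a = b, a = c | b = c].
Proof.
move=> Ga Gb Gc aa ab ac; apply: contrapT => ne.
have nab : a <> b by move=> E; apply: ne; constructor 1.
have nac : a <> c by move=> E; apply: ne; constructor 2.
have nbc : b <> c by move=> E; apply: ne; constructor 3.
pose s := b * S c; pose t := a * S c.
have Gs : grouplike D s by apply: grouplikeM (grouplikeS _).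
have Gt : grouplike D t by apply: grouplikeM (grouplikeS _).
have Sc x : x * c = c * x -> S c * x = x * S c.
  by move=> xc; apply: (mulg_injr Gc); rewrite (mulSg _ Gc) -mulrA xc mulrA antipode_mull // mul1r.
have st : s * a = t * b.
  rewrite /s /t -!mulrA !Sc; try exact: arrow_targets_comm.
  by rewrite !mulrA (arrow_targets_comm Ga Gb).
have sc : s * c = b by exact: mulSg.
have tc : t * c = a by exact: mulSg.
have s1 : s <> 1 by move=> E; apply: nbc; rewrite -sc E mul1r.
have t1 : t <> 1 by move=> E; apply: nac; rewrite -tc E mul1r.
have nst : s <> t by move=> E; apply: nab; rewrite -sc -tc E.
apply: (@no_arrow_cycle 3 (nth 1 [:: 1; s; t]) (nth 1 [:: a; b; s * a])) => //.
- by case=> [|[|[|]]] // _; apply: grouplike1.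
- by case=> [|[|[|]]] // _; apply: grouplikeM.
- move=> i j ij; have : (i = 0 /\ j = 1 \/ i = 0 /\ j = 2 \/ i = 1 /\ j = 2)%N by lia.
  move=> [[-> ->]|[[-> ->]|[-> ->]]] //=.
    by move/esym.
  by move/esym.
- move=> i j ij; have : (i = 0 /\ j = 1 \/ i = 0 /\ j = 2 \/ i = 1 /\ j = 2)%N by lia.
  move=> [[-> ->]|[[-> ->]|[-> ->]]] //=.
    by rewrite -{1}[a]mul1r => /(mulg_injr Ga)/esym.
  by rewrite st -{1}[b]mul1r => /(mulg_injr Gb)/esym.
case=> [|[|[|]]] //= _; split=> //.
- by rewrite -[X in arrow _ X]sc; apply: arrow_from.
- exact: arrow_from.
- by rewrite st; apply: arrow_from.
- by rewrite -[X in arrow _ X]tc; apply: arrow_from.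
Qed.

(** If [t = a * S b] had finite order [N], the arrows from [t ^+ i] to [t ^+ i * b] and to
    [t ^+ i * a = t ^+ i.+1 * b] would close up after [N] steps. Here [N > 1] since [a <> b]. *)
Lemma arrow_quotient_infinite_order a b n : grouplike D a -> grouplike D b ->
  arrow 1 a -> arrow 1 b -> a <> b -> (0 < n)%N -> (a * S b) ^+ n <> 1.
Proof.
move=> Ga Gb aa ab nab n_gt0 tn.
pose t := a * S b; pose P k := (0 < k)%N && (t ^+ k == 1).
have exP : exists k, P k by exists n; apply/andP; split=> //; apply/eqP.
have [N /andP[N_gt0 /eqP tN] minN] := ex_minnP exP.
have Gt : grouplike D t by apply: grouplikeM (grouplikeS _).
have tb : t * b = a by exact: mulSg.
have GtX k := grouplikeX k Gt.
have tX_neq i j : (i < j < N)%N -> t ^+ i <> t ^+ j.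
  move=> /andP[ij jN]; rewrite -(subnKC (ltnW ij)) exprD -{1}[t ^+ i]mulr1.
  move=> /(mulg_injl (GtX i))/esym/eqP E.
  have := minN (j - i)%N; rewrite /P subn_gt0 ij E => /(_ isT).
  by rewrite leqNgt (leq_ltn_trans (leq_subr _ _) jN).
apply: (@no_arrow_cycle N (fun i => t ^+ i) (fun i => t ^+ i * b)) => //.
- rewrite ltn_neqAle N_gt0 andbT; apply/eqP => N1; apply: nab.
  by rewrite -tb -[t]expr1 N1 tN mul1r.
- by move=> i _; apply: grouplikeM.
- by move=> i j ij /(mulg_injr Gb); apply: tX_neq.
move=> i iN; split; first exact: arrow_from.
have -> : t ^+ (i.+1 %% N)%N * b = t ^+ i * a.
  have -> : t ^+ (i.+1 %% N)%N = t ^+ i.+1.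
    by rewrite [in RHS](divn_eq i.+1 N) exprD mulnC exprM tN expr1n mul1r.
  by rewrite exprSr -mulrA tb.
exact: arrow_from.
Qed.

End Discrete.
End HopfGrouplikes.

(** * The link-indecomposable component of 1 and its vertices *)

Section LinkComponent.
Context {K : fieldType} {H : algType K} {D : H -> seq (H * H)} {e : H -> K} {S : H -> H}.
Context {B : H -> Prop}.
Context (hopfD : is_hopf D e S) (linkB : link_component_one D B).

Local Notation arrow := (has_arrow D (fun _ => True)).
Local Notation adjacent C :=
  (fun u v => GL D C v /\ (has_arrow D C u v \/ has_arrow D C v u)).

Let coalgD : is_coalgebra D e. Proof. by case: hopfD. Qed.

Lemma walk_cat (R : H -> H -> Prop) x y z s t :
  walk R x s y -> walk R y t z -> walk R x (s ++ t) z.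
Proof. by elim: s x => [x ->|w s IH x [Rxw sy] tz] //=; split=> //; apply: IH. Qed.

Lemma walk_mono (R R' : H -> H -> Prop) x y s :
  (forall u v, R u v -> R' u v) -> walk R x s y -> walk R' x s y.
Proof. by move=> RR'; elim: s x => [//|w s IH x [/RR' Rxw /IH]]. Qed.

Lemma has_arrow_mono (C C' : H -> Prop) g h :
  (forall x, C x -> C' x) -> has_arrow D C g h -> has_arrow D C' g h.
Proof. by move=> CC' [x [Cx [Dx nx]]]; exists x; split; [apply: CC'|]. Qed.

Lemma subspace_line (g : H) : subspace (fun x => exists a : K, x = a *: g).
Proof.
split; first by exists 0; rewrite scale0r.
by move=> a x y [b ->] [c ->]; exists (a * b + c); rewrite scalerDl scalerA.
Qed.

Lemma grouplike_line g k : grouplike D g -> grouplike D k ->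
  (exists a : K, k = a *: g) -> k = g.
Proof.
move=> Gg Gk [a ka]; have ek := counit_grouplike coalgD Gk; move: ek.
have [el _] := coalgD; have e0 := counit0 coalgD.
rewrite ka -[a *: g]addr0 el e0 !addr0 (counit_grouplike coalgD Gg) mulr1 => ->.
by rewrite scale1r.
Qed.

(** Adjoining [g], [h] and [x] to [B] gives a connected subcoalgebra, which lies in [B] by
    maximality. *)
Lemma link_component_closed g h x : grouplike D g -> grouplike D h ->
  B g \/ B h -> skewprim D g h x -> (forall b, x <> b *: (g - h)) ->
  [/\ B g, B h & B x].
Proof.
move=> Gg Gh Bgh Dx nx.
have [[BS Bco] [B1 [Bconn Bmax]]] := linkB.
pose B' v := exists a b c w, v = a *: g + (b *: h + (c *: x + w)) /\ B w.
have BB' w : B w -> B' w.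
  by move=> Bw; exists 0, 0, 0, w; rewrite !scale0r !add0r.
have B0 : B 0 by case: BS.
have B'g : B' g by exists 1, 0, 0, 0; rewrite !scale0r scale1r !addr0.
have B'h : B' h by exists 0, 1, 0, 0; rewrite !scale0r scale1r !addr0 add0r.
have B'x : B' x by exists 0, 0, 1, 0; rewrite !scale0r scale1r !addr0 !add0r.
have B'S : subspace B'.
  split; first exact: BB'.
  move=> k u v [a [b [c [w [-> Bw]]]]] [a' [b' [c' [w' [-> Bw']]]]].
  exists (k * a + a'), (k * b + b'), (k * c + c'), (k *: w + w').
  split; last by case: BS => _; apply.
  by rewrite !scalerDr !scalerDl !scalerA addrACA; congr (_ + _);
     rewrite addrACA; congr (_ + _); rewrite addrACA.
have B'D v : B' v -> exists s, teq2 (D v) s /\ forall p, p \in s ->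
    [\/ B p.1 /\ B p.2, (exists a, p.1 = a *: g) /\ (p.2 = g \/ p.2 = x)
      | ((exists b, p.1 = b *: h) \/ (exists b, p.1 = b *: x)) /\ p.2 = h].
  move=> [a [b [c [w [-> Bw]]]]]; have [s [Ds sB]] := Bco _ Bw.
  exists ([:: (a *: g, g); (b *: h, h); (c *: g, x); (c *: x, h)] ++ s); split.
    move=> f fB; rewrite !(comul_linear coalgD) // (Ds f fB).
    rewrite (grouplike_form fB Gg) (grouplike_form fB Gh) (skewprim_form fB Dx).
    rewrite big_cat !big_cons big_nil /= addr0.
    by rewrite !(bilinZl _ _ _ fB) mulrDr !addrA.
  move=> p; rewrite mem_cat !inE -!orbA => /or4P[/eqP->|/eqP->|/eqP->|/orP[/eqP->|/sB]] /=.
  - by constructor 2; split; [exists a|left].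
  - by constructor 3; split=> //; left; exists b.
  - by constructor 2; split; [exists c|right].
  - by constructor 3; split=> //; right; exists c.
  - by constructor 1.
have B'co : subcoalg D B'.
  split=> // v /B'D[s [Ds sP]]; exists s; split=> // p /sP[[/BB' ? /BB' ?]|[[a ->] p2]|[p1 ->]] //.
    by split; [exact: subspaceZ|case: p2 => ->].
  by split=> //; case: p1 => -[b ->]; exact: subspaceZ.
(* If [g] lies in [B], each tensor in the coproduct of an element of [B'] has its left leg in [B] or
   its right leg in the line of [h], so by [grouplike_wedge] the only possible new grouplike is [h];
   symmetrically with [g] if [h] lies in [B]. *)
have GLB' k : GL D B' k -> [\/ B k, k = g | k = h].
  move=> [Gk B'k].
  case: Bgh => [Bg|Bh].
    have wd w : B' w -> exists s, teq2 (D w) s /\ forall p, p \in s ->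
        B p.1 \/ (exists a : K, p.2 = a *: h).
      move=> /B'D[s [Ds sP]]; exists s; split=> // p /sP[[]|[[a ->] _]|[_ ->]]; first by left.
        by left; exact: subspaceZ.
      by right; exists 1; rewrite scale1r.
    case: (grouplike_wedge BS (subspace_line h) Gk B'k wd) => [|kh]; first by constructor 1.
    by constructor 3; apply: grouplike_line kh.
  have wd w : B' w -> exists s, teq2 (D w) s /\ forall p, p \in s ->
      (exists a : K, p.1 = a *: g) \/ B p.2.
    move=> /B'D[s [Ds sP]]; exists s; split=> // p /sP[[]|[[a ->] _]|[_ ->]]; first by right.
      by left; exists a.
    by right.
  case: (grouplike_wedge (subspace_line g) BS Gk B'k wd) => [kg|]; last by constructor 1.
  by constructor 2; apply: grouplike_line kg.
have agh : has_arrow D B' g h by exists x.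
(* The base vertex [g0] is the endpoint known to lie in [B]; the new arrow links the other endpoint
   to it. *)
have [g0 [GLg0 [s1 w1] [s2 w2] [s3 w3] [s4 w4]]] : exists g0, [/\ GL D B g0,
    exists s, walk (adjacent B') g0 s g, exists s, walk (adjacent B') g s g0,
    exists s, walk (adjacent B') g0 s h & exists s, walk (adjacent B') h s g0].
  case: Bgh => [Bg|Bh]; [exists g | exists h].
    by split=> //; [exists [::]|exists [::]|exists [:: h]|exists [:: g]] => //=;
      split=> //; split=> //; by [left|right].
  by split=> //; [exists [:: g]|exists [:: h]|exists [::]|exists [::]] => //=;
    split=> //; split=> //; by [left|right].
have walkBB' u s v : walk (adjacent B) u s v -> walk (adjacent B') u s v.
  apply: walk_mono => {}u {}v [[Gv Bv] uv]; split; first by split; [|apply: BB'].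
  by case: uv => /(has_arrow_mono BB'); [left|right].
have to_from k : GL D B' k ->
    (exists s, walk (adjacent B') g0 s k) /\ (exists s, walk (adjacent B') k s g0).
  move=> GLk; have [Bk|->|->] := GLB' _ GLk.
  - have GLBk : GL D B k by case: GLk.
    have [s /walkBB' ws] := Bconn _ _ GLg0 GLBk.
    by have [t /walkBB' wt] := Bconn _ _ GLBk GLg0; split; [exists s|exists t].
  - by split; [exists s1|exists s2].
  - by split; [exists s3|exists s4].
have B'conn : quiver_connected D B'.
  move=> u v /to_from[_ [s us]] /to_from[[t tv] _].
  by exists (s ++ t); apply: walk_cat us tv.
have B'B := Bmax _ B'co (BB' _ B1) BB' B'conn.
by split; apply: B'B.
Qed.

Lemma link_component_arrow g h : grouplike D g -> grouplike D h ->
  arrow g h -> B g <-> B h.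
Proof.
move=> Gg Gh [x [_ [Dx nx]]].
by split=> Bgh; case: (link_component_closed Gg Gh _ Dx nx) => //; [left|right].
Qed.

Lemma link_component_skewprim g h x : GL D B g -> GL D B h ->
  skewprim D g h x -> B x.
Proof.
move=> [Gg Bg] [Gh Bh] Dx; have [[BS _] _] := linkB.
have [[b ->]|nx] := pselect (exists b : K, x = b *: (g - h)).
  by apply: subspaceZ => //; apply: subspaceB.
have nx' b : x <> b *: (g - h) by move=> xb; apply: nx; exists b.
by case: (link_component_closed Gg Gh (or_introl Bg) Dx nx').
Qed.

(** For vertices of [B] the whole of [P(g, h)] lies in [B], so arrows may be counted in [H] or in
    [B]. *)
Lemma link_component_arrows g h k : GL D B g -> GL D B h ->
  arrows D (fun _ => True) g h k <-> arrows D B g h k.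
Proof.
move=> GLg GLh; split=> -[x [xP [indep span]]]; exists x; split.
- move=> i; have [_ Dx] := xP i; split=> //; exact: (link_component_skewprim GLg GLh).
- by split=> // y _ Dy; apply: span.
- by move=> i; have [_ Dx] := xP i.
- by split=> // y _ Dy; apply: span => //; apply: (link_component_skewprim GLg GLh).
Qed.

Lemma GL1 : GL D B 1.
Proof. by split; [exact: (grouplike1 hopfD)|case: linkB => _ []]. Qed.

Lemma GL_arrow u a : GL D B u -> grouplike D a -> arrow 1 a ->
  GL D B (u * a) /\ GL D B (u * S a).
Proof.
move=> [Gu Bu] Ga aa; have GSa := grouplikeS hopfD Ga.
split; (split; first exact: (grouplikeM hopfD)).
  apply/(link_component_arrow Gu _ (arrow_from hopfD Gu aa)) => //.
  exact: (grouplikeM hopfD).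
have GuSa := grouplikeM hopfD Gu GSa.
have := arrow_from hopfD GuSa aa; rewrite (mulSg hopfD) //.
by move=> /(link_component_arrow GuSa Gu) ->.
Qed.

(** A walk from 1 multiplies on the right by a target of an arrow at 1 for each arrow followed
    forwards, and by the inverse of one for each arrow followed backwards: such targets generate
    [G(B)]. *)
Lemma GL_ind (P : H -> Prop) : P 1 ->
  (forall u a, grouplike D u -> P u -> grouplike D a -> arrow 1 a ->
     P (u * a) /\ P (u * S a)) ->
  forall g, GL D B g -> P g.
Proof.
move=> P1 PM g GLg; have [_ [_ [Bconn _]]] := linkB.
have [s] := Bconn _ _ GL1 GLg; have G1 := grouplike1 hopfD.
elim: s 1 G1 P1 => [u _ Pu /= <- //|v s IH u Gu Pu /= [[[Gv _] uv]] ws].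
apply: IH ws => //.
case: uv => /(has_arrow_mono (fun _ _ => I)) uv.
  have vE : v = u * (S u * v) by rewrite mulrA (antipode_mulr hopfD) // mul1r.
  rewrite vE; apply: (PM _ _ Gu Pu _ (arrow_quotient hopfD Gu uv)).1.
  by apply: (grouplikeM hopfD) => //; apply: (grouplikeS hopfD).
have Ga : grouplike D (S v * u).
  by apply: (grouplikeM hopfD) => //; apply: (grouplikeS hopfD).
have vE : v = u * S (S v * u).
  apply: (mulg_injr hopfD Ga); rewrite (mulSg hopfD) //.
  by rewrite mulrA (antipode_mulr hopfD) // mul1r.
by rewrite vE; apply: (PM _ _ Gu Pu Ga (arrow_quotient hopfD Gv uv)).2.
Qed.

Lemma no_arrow_arrows0 g h : ~ arrow g h -> arrows D (fun _ => True) g h 0.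
Proof.
move=> ngh; exists (fun=> 0); split; first by case.
split; first by move=> c b _ [].
move=> y _ Dy; exists (fun=> 0); apply: contrapT => ny; apply: ngh; exists y.
split=> //; split=> // b yb; apply: ny; exists b.
by rewrite big_ord0 add0r.
Qed.

Lemma arrows_mull u g h k : grouplike D u ->
  arrows D (fun _ => True) (u * g) (u * h) k <-> arrows D (fun _ => True) g h k.
Proof.
have dir v g' h' : grouplike D v -> arrows D (fun _ => True) g' h' k ->
    arrows D (fun _ => True) (v * g') (v * h') k.
  move=> Gv [x [xP [indep span]]]; exists (fun i => v * x i).
  have sumE (c : 'I_k -> K) : \sum_i c i *: (v * x i) = v * \sum_i c i *: x i.
    by rewrite mulr_sumr; apply: eq_bigr => i _; rewrite scalerAr.
  split=> [i|]; first by split=> //; apply: (skewprim_mull hopfD) => //; case: (xP i).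
  split=> [c b|y _ Dy].
    by rewrite sumE -mulrBr scalerAr => /(mulg_injl hopfD Gv); apply: indep.
  have GSv := grouplikeS hopfD Gv.
  have := skewprim_mull hopfD GSv Dy.
  rewrite !mulrA (antipode_mull hopfD) // !mul1r => /(span _ I)[c [b yE]].
  exists c, b; rewrite sumE -mulrBr scalerAr -mulrDr -yE.
  by rewrite mulrA (antipode_mulr hopfD) // mul1r.
move=> Gu; split=> [/(dir (S u))|]; last exact: dir.
by rewrite !mulrA (antipode_mull hopfD) // !mul1r; apply; apply: (grouplikeS hopfD).
Qed.

Lemma arrow_arrows1 (Kinf : forall s : seq K, exists a, a \notin s)
    (discD : discrete_corep D e) g h :
  grouplike D g -> grouplike D h -> arrow g h -> arrows D (fun _ => True) g h 1.
Proof.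
move=> Gg Gh [x [_ [Dx nx]]]; exists (fun=> x); split=> //; split.
  move=> c b; rewrite big_ord1 => cb i; rewrite (ord1 i); apply/eqP; apply: contraT => c0.
  case: (nx ((c ord0)^-1 * b)); rewrite -scalerA -cb scalerA mulVf //.
  by rewrite scale1r.
move=> y _ Dy.
have [c [b ->]] := skewprim_space_dim1 hopfD Kinf discD Gg Gh Dx nx Dy.
by exists (fun=> c), b; rewrite big_ord1.
Qed.

End LinkComponent.

(** * Integer powers and subgroups of the integers *)

Section IntPowers.
Context {R : nzRingType}.

(* [b] is meant to be the inverse of [a]. *)
Definition int_power (a b : R) (i : int) : R :=
  match i with Posz n => a ^+ n | Negz n => b ^+ n.+1 end.

Lemma int_powerS (a b : R) i : b * a = 1 -> int_power a b (i + 1) = int_power a b i * a.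
Proof.
move=> ba; case: i => [n|[|n]].
- by rewrite -PoszD addn1 /= exprSr.
- by rewrite /= expr1 ba.
- by rewrite (_ : Negz n.+1 + 1 = Negz n) ?NegzE; [rewrite /= [in RHS]exprSr -mulrA ba mulr1|lia].
Qed.

Lemma int_powerD (a b : R) i j : a * b = 1 -> b * a = 1 ->
  int_power a b (i + j) = int_power a b i * int_power a b j.
Proof.
move=> ab ba; elim/int_ind: j => [|n IH|n IH]; first by rewrite addr0 mulr1.
  by rewrite -addn1 PoszD addrA !int_powerS // IH mulrA.
have V k : int_power a b (k - 1) = int_power a b k * b.
  by rewrite -{2}[k](subrK 1) int_powerS // -mulrA ab mulr1.
by rewrite -addn1 PoszD opprD addrA !V IH mulrA.
Qed.

Lemma int_power_comm (a b x : R) i : GRing.comm x a -> GRing.comm x b ->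
  GRing.comm x (int_power a b i).
Proof. by move=> xa xb; case: i => n; apply: commrX. Qed.

End IntPowers.

(** The generator is the least positive member, by division with remainder, or 0 when no member is
    positive. *)
Lemma int_subgroup_cyclic (P : int -> Prop) :
  P 0 -> (forall i j, P i -> P j -> P (i - j)) ->
  exists n : nat, forall i, P i <-> (n%:Z %| i)%Z.
Proof.
move=> P0 PB.
have PN i : P i -> P (- i) by move=> Pi; rewrite -sub0r; apply: PB.
have PD i j : P i -> P j -> P (i + j) by move=> Pi Pj; rewrite -[j]opprK; apply/PB/PN.
have PM i k : P i -> P (k * i).
  move=> Pi; elim/int_ind: k => [|k IH|k IH]; first by rewrite mul0r.
    by rewrite -addn1 PoszD mulrDl mul1r; apply: PD.
  by rewrite -addn1 PoszD opprD mulrDl mulN1r; apply: PB.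
have [[n n_gt0 Pn]|noP] := pselect (exists2 n : nat, (0 < n)%N & P n); last first.
  exists 0%N => i; rewrite dvd0z; split=> [Pi|/eqP -> //]; apply: contraT => i0.
  case: noP; exists `|i|%N; first by rewrite absz_gt0.
  by rewrite abszE; case: (ler0P i) => _ //; apply: PN.
pose Q k := (0 < k)%N && `[< P k%:Z >].
have exQ : exists k, Q k by exists n; rewrite /Q n_gt0; apply/asboolP.
have [m /andP[m_gt0 /asboolP Pm] minm] := ex_minnP exQ.
exists m => i; split=> [Pi|/dvdzP[q ->]]; last exact: PM.
apply/dvdz_mod0P/eqP; apply: contraT => r0.
have Pr : P (i %% m)%Z by rewrite /modz; apply: PB Pi _; apply: PM.
have m0 : m%:Z != 0 by rewrite -lt0n.
have := ltz_mod i m0; have := modz_ge0 i m0; move: r0 Pr.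
case: (i %% m)%Z => // r r0 Pr _ rm.
have := minm r; rewrite /Q lt0n; move: r0; rewrite -[r == 0 :> int]/(r == 0)%N => -> /=.
by rewrite leqNgt; move: rm; rewrite /= ltz_nat => -> /(_ (asboolT Pr)).
Qed.

(** A root of [q + 1], where [q] is the product of the factors ['X - a%:P] over a nonempty list,
    avoids that list. *)
Lemma closed_field_infinite (K : closedFieldType) (s : seq K) : exists a, a \notin s.
Proof.
case: s => [|a0 s]; first by exists 0.
pose q : {poly K} := \prod_(a <- a0 :: s) ('X - a%:P).
have sq : size q = (size s).+2 by rewrite size_prod_XsubC.
have /closed_rootP[a] : size (q + 1) != 1%N by rewrite size_polyDl ?size_poly1 sq.
rewrite rootE hornerD hornerC => ra; exists a; apply/negP => as_.
have : root q a by rewrite root_prod_XsubC.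
by rewrite rootE => /eqP qa; move: ra; rewrite qa add0r oner_eq0.
Qed.

(** * Vertices and arrows of the component, by the number of arrow targets at 1 *)

Section Classification.
Context {K : closedFieldType} {H : algType K} {D : H -> seq (H * H)}.
Context {e : H -> K} {S : H -> H} {B : H -> Prop}.
Context (hopfD : is_hopf D e S) (discD : discrete_corep D e) (linkB : link_component_one D B).

Local Notation arrow := (has_arrow D (fun _ => True)).

Lemma GL_arrows g h : GL D B g -> GL D B h ->
  (arrow g h -> arrows D B g h 1) /\ (~ arrow g h -> arrows D B g h 0).
Proof.
move=> GLg GLh; split=> gh; apply/(link_component_arrows hopfD linkB _ GLg GLh).
  by case: GLg GLh => [Gg _] [Gh _];
    exact: (arrow_arrows1 hopfD (@closed_field_infinite K) discD).
exact: no_arrow_arrows0.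
Qed.

Lemma GL_int_power u a i : GL D B u -> grouplike D a -> arrow 1 a ->
  GL D B (u * int_power a (S a) i).
Proof.
move=> GLu Ga aa.
have X n (b : H) : (forall v, GL D B v -> GL D B (v * b)) -> GL D B (u * b ^+ n).
  move=> stab; elim: n => [|n IH]; first by rewrite mulr1.
  by rewrite exprSr mulrA; apply: stab.
by case: i => n; apply: X => v GLv; case: (GL_arrow hopfD linkB GLv Ga aa).
Qed.

(** An arrow from [u] to [v] translates to one from 1 to [S u * v], which must be [a]. The kernel of
    [phi] stays open here: it separates the cycle from the line. *)
Lemma GL_one_target a : grouplike D a -> arrow 1 a ->
  (forall b, grouplike D b -> arrow 1 b -> b = a) ->
  let phi := int_power a (S a) in
  (forall g, GL D B g <-> exists i, g = phi i) /\
  (forall i j, arrows D B (phi i) (phi j) (phi j == phi (i + 1))).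
Proof.
move=> Ga aa uniq_a phi.
have aV : S a * a = 1 by exact: (antipode_mull hopfD).
have Va : a * S a = 1 by exact: (antipode_mulr hopfD).
have GLphi i : GL D B (phi i).
  by rewrite -[phi i]mul1r; apply: GL_int_power => //; apply: (GL1 hopfD linkB).
have phiS i : phi (i + 1) = phi i * a by exact: int_powerS.
split=> [g|i j].
  split=> [|[i ->] //]; move: g; apply: (GL_ind hopfD linkB); first by exists 0.
  move=> u b _ [i ->] Gb /(uniq_a _ Gb) ->; split; first by exists (i + 1).
  exists (i - 1); apply: (mulg_injr hopfD Ga).
  by rewrite (mulSg hopfD) // -phiS subrK.
have [arr narr] := GL_arrows (GLphi i) (GLphi j); have [Gi _] := GLphi i.
have [ji|ji] := eqVneq (phi j) (phi (i + 1)).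
  by apply: arr; rewrite ji phiS; apply: (arrow_from hopfD).
apply: narr => ij; move/eqP: ji; apply; rewrite phiS.
rewrite -(uniq_a (S (phi i) * phi j)) ?mulrA ?(antipode_mulr hopfD) ?mul1r //.
  by apply: (grouplikeM hopfD); [apply: (grouplikeS hopfD)|case: (GLphi j)].
exact: (arrow_quotient hopfD).
Qed.

(** The vertices are the products of powers of the commuting targets [a] and [b]; the relations
    among them form the kernel of [phi], shown to be generated by one vector. *)
Lemma GL_two_targets a b : grouplike D a -> grouplike D b ->
  arrow 1 a -> arrow 1 b -> a <> b ->
  exists (m n : int) (phi : int -> int -> H),
   ~ (m = 1 /\ n = 1) /\ ~ (m = -1 /\ n = -1) /\
   phi 0 0 = 1 /\
   (forall i j i' j', phi (i + i') (j + j') = phi i j * phi i' j') /\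
   (forall g, GL D B g <-> exists i j, g = phi i j) /\
   (forall i j, phi i j = 1 <-> exists k : int, i = k * m /\ j = - (k * n)) /\
   (forall i j i' j', arrows D B (phi i j) (phi i' j')
      (addn (phi i' j' == phi (i + 1) j) (phi i' j' == phi i (j + 1)))).
Proof.
move=> Ga Gb aa ab nab; have Kinf := @closed_field_infinite K.
have aV : S a * a = 1 by exact: (antipode_mull hopfD).
have Va : a * S a = 1 by exact: (antipode_mulr hopfD).
have bV : S b * b = 1 by exact: (antipode_mull hopfD).
have Vb : b * S b = 1 by exact: (antipode_mulr hopfD).
have targets x : grouplike D x -> arrow 1 x -> x = a \/ x = b.
  move=> Gx ax.
  by case: (arrow_targets_le2 hopfD Kinf discD Ga Gb Gx aa ab ax) => [/nab|<-|<-] //; [left|right].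
have commS x y : grouplike D y -> GRing.comm x y -> GRing.comm x (S y).
  move=> Gy xy; apply: (mulg_injr hopfD Gy).
  by rewrite (mulSg hopfD) // -mulrA xy mulrA (antipode_mull hopfD) // mul1r.
have cab : GRing.comm b a by exact: (arrow_targets_comm hopfD Kinf discD).
pose pa := int_power a (S a); pose pb := int_power b (S b).
have cbpa i : GRing.comm b (pa i).
  by apply: int_power_comm; [exact: cab|exact: commS].
have cpapb i j : GRing.comm (pb j) (pa i).
  have cpab : GRing.comm (pa i) b by exact: commr_sym.
  by apply/commr_sym/int_power_comm; [exact: cpab|exact: commS].
pose phi i j := pa i * pb j.
have phiD i j i' j' : phi (i + i') (j + j') = phi i j * phi i' j'.
  rewrite /phi /pa /pb !int_powerD // -!mulrA; congr (_ * _).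
  by rewrite [RHS]mulrA -/pa -/pb cpapb -mulrA.
have phi00 : phi 0 0 = 1 by rewrite /phi /pa /pb /= mulr1.
have phi10 : phi 1 0 = a by rewrite /phi /pa /pb /= mulr1.
have phi01 : phi 0 1 = b by rewrite /phi /pa /pb /= mul1r.
have phiV10 : phi (-1) 0 = S a by rewrite /phi /pa /pb /= mulr1.
have phiV01 : phi 0 (-1) = S b by rewrite /phi /pa /pb /= mul1r.
have phiSl i j : phi (i + 1) j = phi i j * a by rewrite -phi10 -phiD addr0.
have phiSr i j : phi i (j + 1) = phi i j * b by rewrite -phi01 -phiD addr0.
have GLphi i j : GL D B (phi i j).
  apply: GL_int_power => //; rewrite -[pa i]mul1r.
  by apply: GL_int_power => //; apply: (GL1 hopfD linkB).
have kerB i j i' j' : phi i j = 1 -> phi i' j' = 1 -> phi (i - i') (j - j') = 1.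
  move=> ij ij'; have := phiD (i - i') (j - j') i' j'.
  by rewrite !subrK ij ij' mulr1.
have kerZ k i j : phi i j = 1 -> phi (k * i) (k * j) = 1.
  move=> ij; elim/int_ind: k => [|k IH|k IH]; first by rewrite !mul0r.
    by rewrite -addn1 PoszD !mulrDl !mul1r phiD IH ij mulr1.
  by rewrite -addn1 PoszD opprD !mulrDl !mulN1r; apply: kerB.
(* [phi r (- r)] is the power of [a * S b] with exponent [r], and this quotient has infinite
   order. *)
have ker_anti r : phi r (- r) = 1 -> r = 0.
  have pos k : phi k%:Z (- k%:Z) = 1 -> k = 0%N.
    have -> : phi k%:Z (- k%:Z) = (a * S b) ^+ k.
      elim: k => [|k IH]; first exact: phi00.
      rewrite exprSr -IH -addn1 PoszD opprD phiD; congr (_ * _).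
    case: k => // k tk.
    by case: (arrow_quotient_infinite_order hopfD Kinf discD Ga Gb aa ab nab (ltn0Sn k) tk).
  have [r0 rE|r0 rE] := lerP 0 r.
    by have := pos `|r|%N; rewrite gez0_abs // => /(_ rE)/eqP; rewrite absz_eq0 => /eqP.
  have := pos `|r|%N; rewrite ltz0_abs // opprK => kr.
  have /kr/eqP : phi (- r) r = 1.
    by have := kerB 0 0 r (- r) phi00 rE; rewrite !sub0r opprK.
  by rewrite absz_eq0 => /eqP.
(* The image of the kernel under [i + j], a subgroup of the integers. *)
pose P s := exists i j, phi i j = 1 /\ s = i + j.
have [d dP] : exists d : nat, forall s, P s <-> (d%:Z %| s)%Z.
  apply: int_subgroup_cyclic; first by exists 0, 0.
  move=> s s' [i [j [ij ->]]] [i' [j' [ij' ->]]].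
  exists (i - i'), (j - j'); split; first exact: kerB.
  by rewrite opprD addrACA.
have /dP[m [m' [mm' dE]]] : (d%:Z %| d%:Z)%Z by rewrite dvdzz.
(* The kernel vector over the generator [d] is [(m, m')], that is [a^m b^m' = 1]; the sign turns
   this into [a^m = b^n]. *)
exists m, (- m'), phi.
(* The pairs [(1, 1)] and [(-1, -1)] would put [(r, - r)] with [r] nonzero in the kernel. *)
have m_anti r : m = r -> - m' = r -> r = 0.
  by move=> mr mr'; apply: ker_anti; rewrite -{1}mr -mr' opprK.
split; first by case=> m1 m1'; have := m_anti _ m1 m1'.
split; first by case=> m1 m1'; have := m_anti _ m1 m1'.
split=> //; split=> //; split.
  move=> g; split=> [|[i [j ->]] //]; move: g.
  apply: (GL_ind hopfD linkB); first by exists 0, 0.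
  move=> u x _ [i [j ->]] Gx /(targets _ Gx)[->|->]; split.
  - by exists (i + 1), j.
  - by exists (i - 1), j; rewrite -phiV10 -phiD addr0.
  - by exists i, (j + 1).
  - by exists i, (j - 1); rewrite -phiV01 -phiD addr0.
split=> [i j|i j i' j'].
  split=> [ij|[k [-> ->]]]; last by rewrite mulrN opprK; apply: kerZ.
  (* Subtracting [k] times [(m, m')] leaves a kernel vector with coordinate sum 0, which is zero by
     [ker_anti]. *)
  have /dP/dvdzP[k kE] : P (i + j) by exists i, j.
  have := kerB _ _ _ _ ij (kerZ k _ _ mm') => kerk.
  have jE : j - k * m' = - (i - k * m).
    by move: kE; rewrite dE mulrDr; lia.
  move: kerk; rewrite jE => /ker_anti i0; exists k.
  split; first by apply/eqP; rewrite -subr_eq0 i0.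
  by rewrite mulrN opprK; apply/eqP; rewrite -subr_eq0 jE i0 oppr0.
rewrite phiSl phiSr; set u := phi i j; set v := phi i' j'.
have [Gu Gv] : grouplike D u /\ grouplike D v by case: (GLphi i j); case: (GLphi i' j').
have [arr narr] := GL_arrows (GLphi i j) (GLphi i' j').
have [va|nva] := eqVneq v (u * a).
  (* As [a <> b], the two indicators are never both 1. *)
  have -> : v == u * b = false by apply/eqP; rewrite va => /(mulg_injl hopfD Gu).
  by apply: arr; rewrite -/u -/v va; apply: (arrow_from hopfD).
have [vb|nvb] := eqVneq v (u * b).
  by apply: arr; rewrite -/u -/v vb; apply: (arrow_from hopfD).
apply: narr => uv.
have vE : v = u * (S u * v) by rewrite mulrA (antipode_mulr hopfD) // mul1r.
case: (targets (S u * v)) => [||E|E].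
- by apply: (grouplikeM hopfD) => //; apply: (grouplikeS hopfD).
- exact: (arrow_quotient hopfD).
- by move: nva; rewrite vE E eqxx.
- by move: nvb; rewrite vE E eqxx.
Qed.

End Classification.

Theorem theorem4p9 (K : closedFieldType) (H : algType K)
  (D : H -> seq (H * H)) (e : H -> K) (S : H -> H) (B : H -> Prop) :
  is_hopf D e S -> pointed D -> discrete_corep D e ->
  link_component_one D B ->
  (* the Ext-quiver Q of M^B and the group G(B) *)
  ( (* (1) single vertex 1, G(B) = {1} *)
    ((forall g, GL D B g <-> g = 1) /\ arrows D B 1 1 0)
    \/
    (* (2) complete oriented cycle, G(B) = <a | a^n = 1> *)
    (exists (n : nat) (phi : int -> H), (0 < n)%N /\
       phi 0 = 1 /\ (forall i j, phi (i + j) = phi i * phi j) /\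
       (forall g, GL D B g <-> exists i, g = phi i) /\
       (forall i, phi i = 1 <-> (n%:Z %| i)%Z) /\
       (forall i j, arrows D B (phi i) (phi j) (phi j == phi (i + 1))))
    \/
    (* (3) doubly infinite linear quiver, G(B) infinite cyclic *)
    (exists phi : int -> H,
       phi 0 = 1 /\ (forall i j, phi (i + j) = phi i * phi j) /\
       (forall g, GL D B g <-> exists i, g = phi i) /\
       (forall i, phi i = 1 <-> i = 0) /\
       (forall i j, arrows D B (phi i) (phi j) (phi j == phi (i + 1))))
    \/
    (* (4) Q^{m,n}, G(B) = <a, b | ab = ba, a^m = b^n>, (m,n) <> +-(1,1) *)
    (exists (m n : int) (phi : int -> int -> H),
       ~ (m = 1 /\ n = 1) /\ ~ (m = -1 /\ n = -1) /\
       phi 0 0 = 1 /\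
       (forall i j i' j', phi (i + i') (j + j') = phi i j * phi i' j') /\
       (forall g, GL D B g <-> exists i j, g = phi i j) /\
       (forall i j, phi i j = 1 <-> exists k : int, i = k * m /\ j = - (k * n)) /\
       (forall i j i' j', arrows D B (phi i j) (phi i' j')
          (addn (phi i' j' == phi (i + 1) j) (phi i' j' == phi i (j + 1))))) )
  /\
  (* the Ext-quiver of M^H is a disjoint union of copies of Q: every
     connected component is isomorphic to Q *)
  (forall u, grouplike D u ->
     exists psi : H -> H,
       (forall x, GL D B x -> grouplike D (psi x)) /\
       (forall x y, GL D B x -> GL D B y -> psi x = psi y -> x = y) /\
       (exists x, GL D B x /\ psi x = u) /\
       (forall x y k, GL D B x -> GL D B y ->
          (arrows D (fun _ => True) (psi x) (psi y) k <-> arrows D B x y k)) /\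
       (forall v x, grouplike D v -> GL D B x ->
          (forall y, GL D B y -> psi y <> v) ->
          arrows D (fun _ => True) v (psi x) 0 /\
          arrows D (fun _ => True) (psi x) v 0)).
Proof.
move=> hopfD _ discD linkB; split; last first.
  (* The component of [u] is the left translate by [u] of that of 1. *)
  move=> u Gu; exists (fun x => u * x); split; first by move=> x [Gx _]; apply: (grouplikeM hopfD).
  split; first by move=> x y _ _; apply: (mulg_injl hopfD).
  split; first by exists 1; rewrite mulr1; split=> //; apply: (GL1 hopfD linkB).
  split=> [x y k GLx GLy|v x Gv [Gx Bx] v_out].
    by rewrite -(link_component_arrows hopfD linkB k GLx GLy); apply: (arrows_mull hopfD).
  have Gux := grouplikeM hopfD Gu Gx; have GSu := grouplikeS hopfD Gu.
  have GSuv := grouplikeM hopfD GSu Gv.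
  (* A vertex [v] outside the translate has [S u * v] outside [B], and an arrow joining it to
     [u * x] would translate to one joining a vertex of [B] to a grouplike outside [B]. *)
  have out : ~ B (S u * v).
    by move=> Bv; apply: (v_out (S u * v)); rewrite // mulrA (antipode_mulr hopfD) // mul1r.
  have SuE : S u * (u * x) = x by rewrite mulrA (antipode_mull hopfD) // mul1r.
  split; apply: no_arrow_arrows0 => /(arrow_mull hopfD GSu); rewrite SuE.
    by move=> /(link_component_arrow hopfD linkB GSuv Gx) vx; apply/out/vx.
  by move=> /(link_component_arrow hopfD linkB Gx GSuv) xv; apply/out/xv.
(* The case is decided by the number of targets of arrows at 1: none, then two, then exactly one. *)
have [[a [Ga aa]]|no_arrow] := pselect (exists a, grouplike D a /\
    has_arrow D (fun _ => True) 1 a); last first.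
  have GL1B := GL1 hopfD linkB; left; split=> [g|].
    split=> [|-> //]; move: g; apply: (GL_ind hopfD linkB) => // u b _ _ Gb ab.
    by case: no_arrow; exists b.
  have [_ narr] := GL_arrows hopfD discD linkB GL1B GL1B; apply: narr => a1.
  by case: no_arrow; exists 1; split=> //; case: GL1B.
right; have [[b [Gb [ab nba]]]|one] := pselect (exists b, grouplike D b /\
    has_arrow D (fun _ => True) 1 b /\ b <> a).
  by right; right; apply: (GL_two_targets hopfD discD linkB Ga Gb) => // /esym.
have uniq_a b : grouplike D b -> has_arrow D (fun _ => True) 1 b -> b = a.
  by move=> Gb ab; apply: contrapT => nba; apply: one; exists b.
have [GLE arrE] := GL_one_target hopfD discD linkB Ga aa uniq_a.
pose phi := int_power a (S a).
have phiD i j : phi (i + j) = phi i * phi j.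
  by apply: int_powerD; [exact: (antipode_mulr hopfD)|exact: (antipode_mull hopfD)].
(* The kernel of [phi] is generated by 0 for the line and by a positive integer, the length, for the
   cycle. *)
have [[|n] kerE] : exists n : nat, forall i, phi i = 1 <-> (n%:Z %| i)%Z.
  apply: int_subgroup_cyclic => // i j i1 j1.
  by have := phiD (i - j) j; rewrite subrK i1 j1 mulr1.
- right; left; exists phi; do 4![split=> //] => i.
  by rewrite kerE dvd0z; split=> [/eqP|->].
- by left; exists n.+1, phi.
Qed.
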